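(* Let $f:\mathbb{R}^n\to\mathbb{R}\cup\{+\infty\}$ be a proper lower semicontinuous semi-algebraic function with $\inf_{x\in\mathbb{R}^n}f(x)>-\infty$, and let $\{x^k\}$ be a sequence generated by the generalized proximal point algorithm (GPPA) with parameter $t>L$ whose set of cluster points is nonempty. Assume that one of the following two settings holds. (a) $f=g_1+g_2-h$ with $g_1:\mathbb{R}^n\to\mathbb{R}\cup\{+\infty\}$ proper and lower semicontinuous, $g_2:\mathbb{R}^n\to\mathbb{R}$ differentiable with $L$-Lipschitz gradient, $h:\mathbb{R}^n\to\mathbb{R}$ convex and differentiable with $L(h)$-Lipschitz gradient, and $f$ has the Kurdyka-Łojasiewicz property at any point of $\operatorname{dom}f$. (b) $f=g-h$ with $g:\mathbb{R}^n\to\mathbb{R}$ differentiable with $L$-Lipschitz gradient, $h:\mathbb{R}^n\to\mathbb{R}$ convex, $f$ has the strong Kurdyka-Łojasiewicz property at any point of $\operatorname{dom}f$, and the GPPA is applied with $g_1=0$, $g_2=g$. Let $x^*$ be the limit of $\{x^k\}$ (which exists in both settings), and suppose that the function $\varphi$ in the Kurdyka-Łojasiewicz property (in setting (a)), respectively the strong Kurdyka-Łojasiewicz property (in setting (b)), of $f$ at $x^*$ has the form $\varphi(s)=cs^{1-\theta}$ for some $\theta\in[0,1)$ and $c>0$. Then: (i) If $\theta=0$, then $\{x^k\}$ converges in a finite number of steps. (ii) If $0<\theta\le\frac12$, then there exist $\mu>0$ and $q\in(0,1)$ such that $\|x^k-x^*\|\le\mu q^k$ for all $k\ge1$. (iii)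 If $\frac12<\theta<1$, then there exists $\mu>0$ such that $\|x^k-x^*\|\le\mu k^{\frac{1-\theta}{1-2\theta}}$ for all $k\ge1$.
   Context: GPPA: for a proper function $g_1$ and $t>0$, $\mathbf{prox}_t^{g_1}(x)=\operatorname{argmin}\{g_1(u)+\frac t2\|u-x\|^2: u\in\mathbb{R}^n\}$ (a set). A GPPA sequence for $f=g_1+g_2-h$ with parameter $t>L$ ($L$ the Lipschitz constant of $\nabla g_2$) is any infinite sequence $\{x^k\}_{k\ge0}$ with $x^0\in\operatorname{dom} g_1=\{x:g_1(x)<+\infty\}$ such that, for each $k\ge0$, there is $y^k\in\partial h(x^k)$ with $x^{k+1}\in\mathbf{prox}_t^{g_1}\big(x^k-\frac{\nabla g_2(x^k)-y^k}{t}\big)$. Converging in a finite number of steps means $x^k=x^*$ for all sufficiently large $k$. Subdifferentials: for convex $h$, $\partial h(\bar x)=\{v:\langle v,x-\bar x\rangle\le h(x)-h(\bar x)\ \forall x\}$. For a lower semicontinuous $\psi$ and $\bar x\in\operatorname{dom}\psi$, $\partial^F\psi(\bar x)=\{v:\liminf_{x\to\bar x}\frac{\psi(x)-\psi(\bar x)-\langle v,x-\bar x\rangle}{\|x-\bar x\|}\ge0\}$ and $\partial^L\psi(\bar x)=\{v:\exists\, x^k\to\bar x,\ \psi(x^k)\to\psi(\bar x),\ v^k\in\partial^F\psi(x^k),\ v^k\to v\}$; both are empty if $\bar x\notin\operatorname{dom}\psi$. For $\psi$ locally Lipschitz around $\bar x$, the Clarke subdifferential is $\partial^C\psi(\bar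 x)=\operatorname{co}\partial^L\psi(\bar x)$; in setting (b), $f$ is locally Lipschitz. Kurdyka-Łojasiewicz property: a lower semicontinuous $f$ has this property at $x^*\in\operatorname{dom}\partial^Lf=\{x:\partial^Lf(x)\ne\emptyset\}$ if there exist $\nu>0$, a neighborhood $\mathcal V$ of $x^*$, and a continuous concave $\varphi:[0,\nu)\to[0,+\infty)$ such that $\varphi(0)=0$; $\varphi$ is $C^1$ on $(0,\nu)$; $\varphi'>0$ on $(0,\nu)$; and for every $x\in\mathcal V$ with $f(x^* )<f(x)<f(x^* )+\nu$ one has $\varphi'(f(x)-f(x^* ))\operatorname{dist}(0,\partial^Lf(x))\ge1$ (with $\operatorname{dist}(0,\emptyset)=+\infty$). The strong Kurdyka-Łojasiewicz property is the same with $\partial^Cf(x)$ in place of $\partial^Lf(x)$. Semi-algebraic: a subset of $\mathbb{R}^m$ is semi-algebraic if it is a finite union of sets of the form $\{x: p_i(x)=0,\ q_i(x)<0,\ i=1,\dots,m'\}$ with $p_i,q_i$ polynomials; a function is semi-algebraic if its graph is a semi-algebraic subset of $\mathbb{R}^{n+1}$. *)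

(* Defs.v *)
From mathcomp Require Import all_boot all_order all_algebra.
From mathcomp Require Import all_classical all_reals all_analysis.
From mathcomp Require mpoly.

Set Implicit Arguments.
Unset Strict Implicit.
Unset Printing Implicit Defensive.

Import Order.TTheory GRing.Theory Num.Theory.
Import numFieldNormedType.Exports.

Local Open Scope classical_set_scope.
Local Open Scope ring_scope.

Section Euclidean.
Context {R : realType} {n : nat}.
Implicit Types u v x y : 'rV[R]_n.

Definition dot u v : R := \sum_i u 0 i * v 0 i.

(* `|x| is the sup norm on 'rV[R]_n; it induces the same topology as the
   Euclidean norm below. *)
Definition enorm u : R := Num.sqrt (dot u u).

(* distance from the origin, +oo for the empty set *)
Definition dist0 (A : set 'rV[R]_n) : \bar R :=
  ereal_inf [set (enorm v)%:E | v in A].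

Definition grad (g : 'rV[R]_n -> R) x : 'rV[R]_n :=
  \row_i 'D_(delta_mx 0 i) g x.

Definition lipschitz_gradient (L : R) (g : 'rV[R]_n -> R) : Prop :=
  [/\ 0 <= L,
      forall x, differentiable g x &
      forall x y, enorm (grad g x - grad g y) <= L * enorm (x - y)].

Definition conv_hull (A : set 'rV[R]_n) : set 'rV[R]_n :=
  [set v | exists m (a : 'I_m -> R) (w : 'I_m -> 'rV[R]_n),
     [/\ forall i, 0 <= a i, \sum_i a i = 1, forall i, A (w i) &
         v = \sum_i a i *: w i]].

Definition edom (psi : 'rV[R]_n -> \bar R) : set 'rV[R]_n :=
  [set x | (psi x < +oo)%E].

Definition proper_fun (psi : 'rV[R]_n -> \bar R) : Prop :=
  (forall x, (-oo < psi x)%E) /\ edom psi !=set0.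

Definition argmin (psi : 'rV[R]_n -> \bar R) : set 'rV[R]_n :=
  [set u | forall w, (psi u <= psi w)%E].

End Euclidean.

Section SemiAlgebraic.
Context {R : realType}.

Definition semialgebraic_set m (A : set 'rV[R]_m) : Prop :=
  exists S : seq (seq (mpoly.mpoly m R * mpoly.mpoly m R)),
    A = [set z | has (all (fun pq => (mpoly.meval (z 0) pq.1 == 0) &&
                                     (mpoly.meval (z 0) pq.2 < 0))) S].

Definition graph n (psi : 'rV[R]_n -> \bar R) : set 'rV[R]_(n + 1) :=
  [set z | psi (lsubmx z) = (rsubmx z 0 0)%:E].

Definition semialgebraic n (psi : 'rV[R]_n -> \bar R) : Prop :=
  semialgebraic_set (graph psi).

End SemiAlgebraic.

Section Subdifferentials.
Context {R : realType} {n : nat}.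
Implicit Types (psi : 'rV[R]_n -> \bar R) (x : 'rV[R]_n).

Definition subdiff (h : 'rV[R]_n -> R) x : set 'rV[R]_n :=
  [set v | forall y, dot v (y - x) <= h y - h x].

Definition frechet_subdiff psi x : set 'rV[R]_n :=
  [set v | edom psi x /\
    (0 <= limf_einf (fun y => (psi y - psi x - (dot v (y - x))%:E)
                              * ((enorm (y - x))^-1)%:E) (x^'))%E].

Definition limiting_subdiff psi x : set 'rV[R]_n :=
  [set v | edom psi x /\
    exists xs vs : nat -> 'rV[R]_n,
      [/\ xs @ \oo --> x,
          (psi \o xs) @ \oo --> psi x,
          forall k, frechet_subdiff psi (xs k) (vs k) &
          vs @ \oo --> v]].

(* The Clarke subdifferential when psi is locally Lipschitz around x; of no
   meaning otherwise. *)
Definition clarke_subdiff psi x : set 'rV[R]_n :=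
  conv_hull (limiting_subdiff psi x).

End Subdifferentials.

Section KurdykaLojasiewicz.
Context {R : realType} {n : nat}.
Implicit Types (sub : 'rV[R]_n -> set 'rV[R]_n) (f : 'rV[R]_n -> \bar R).

(* With [sub] the limiting (resp. Clarke) subdifferential of [f] this is the
   (resp. strong) Kurdyka-Lojasiewicz property at [xs] with desingularizing
   function [phi], of which only the values on `[0, nu[ matter.  The inequality
   is the whole content: [sub xs] is not required to be nonempty. *)
Definition KL_with sub f (xs : 'rV[R]_n) (phi : R -> R) : Prop :=
  exists (nu : R) (V : set 'rV[R]_n),
    [/\ 0 < nu, nbhs xs V,
        [/\ {within `[0, nu[, continuous phi},
            convex_function `[0, nu[ (\- phi : R -> R^o),
            {in `[0, nu[, forall s, 0 <= phi s} &
            phi 0 = 0],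
        {in `]0, nu[, forall s,
           [/\ derivable phi s 1, {for s, continuous (derive1 phi)} &
               0 < derive1 phi s]} &
        forall x, V x -> (f xs < f x < f xs + nu%:E)%E ->
          (1 <= (derive1 phi (fine (f x - f xs)))%:E * dist0 (sub x))%E].

Definition KL sub f xs : Prop := exists phi, KL_with sub f xs phi.

End KurdykaLojasiewicz.

Section GPPA.
Context {R : realType} {n : nat}.

Definition prox (t : R) (g : 'rV[R]_n -> \bar R) (x : 'rV[R]_n) : set 'rV[R]_n :=
  argmin (fun u => g u + (t / 2 * enorm (u - x) ^+ 2)%:E)%E.

Definition gppa (g1 : 'rV[R]_n -> \bar R) (g2 h : 'rV[R]_n -> R) (t : R)
    (x : nat -> 'rV[R]_n) : Prop :=
  edom g1 (x 0%N) /\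
  forall k, exists2 y, subdiff h (x k) y &
    prox t g1 (x k - t^-1 *: (grad g2 (x k) - y)) (x k.+1).

Definition convex_fun (h : 'rV[R]_n -> R) : Prop :=
  convex_function setT (h : 'rV[R]_n -> R^o).

Definition decomposition (f g1 : 'rV[R]_n -> \bar R) (g2 h : 'rV[R]_n -> R) : Prop :=
  forall x, f x = (g1 x + (g2 x)%:E - (h x)%:E)%E.

Definition setting_a (f g1 : 'rV[R]_n -> \bar R) (g2 h : 'rV[R]_n -> R)
    (L : R) : Prop :=
  [/\ decomposition f g1 g2 h,
      proper_fun g1 /\ lower_semicontinuous g1,
      lipschitz_gradient L g2,
      convex_fun h /\ (exists Lh, lipschitz_gradient Lh h) &
      forall x, edom f x -> KL (limiting_subdiff f) f x].

Definition setting_b (f g1 : 'rV[R]_n -> \bar R) (g2 h : 'rV[R]_n -> R)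
    (L : R) : Prop :=
  [/\ decomposition f g1 g2 h,
      g1 = cst 0%E,
      lipschitz_gradient L g2,
      convex_fun h &
      forall x, edom f x -> KL (clarke_subdiff f) f x].

End GPPA.

(* Main.v *)
Require Import Defs.
From mathcomp Require Import all_boot all_order all_algebra.
From mathcomp Require Import all_classical all_reals all_analysis.
From mathcomp Require Import ring lra.

Set Implicit Arguments.
Unset Strict Implicit.
Unset Printing Implicit Defensive.

Import Order.TTheory GRing.Theory Num.Theory.
Import numFieldNormedType.Exports.

Local Open Scope classical_set_scope.
Local Open Scope ring_scope.

(* Write [d k = |x (k+1) - x k|].  Since [t > L], each step decreases [f] by at
   least [(t - L) / 2 * d k ^+ 2], and the subdifferential of [f] at [x (k+1)]
   is at distance at most [C * (d k + d (k+1))] from the origin.  In setting (a)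
   this is the optimality condition of the proximal step.  In setting (b) it
   rests on [grad g x - p] lying in the closed convex hull of the limiting
   subdifferential of [g - h] for every subgradient [p] of [h] at [x]; instead
   of the almost everywhere differentiability of [h] the proof uses the density
   of the proximal subgradients of [f], which are gradients of [g] minus
   gradients of [h].  The Kurdyka-Lojasiewicz inequality then bounds the length
   of the trajectory near a cluster point, which gives convergence, and
   [|x k - xstar| <= 2 * d k + M * phi (r (k+1))] for the values
   [r k = f (x k) - f xstar].  With [phi s = c * s `^ (1 - theta)] the values obey
   [r (k+2) `^ (2 * theta) <= K * (r k - r (k+2))], whence the three regimes. *)

(** * Euclidean norm *)

Section EuclideanTheory.
Context {R : realType} {n : nat}.
Implicit Types (u v w x y : 'rV[R]_n) (a : R).

Lemma dotC u v : dot u v = dot v u.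
Proof. by apply: eq_bigr => i _; rewrite mulrC. Qed.

Lemma dotDl u v w : dot (u + v) w = dot u w + dot v w.
Proof. by rewrite -big_split; apply: eq_bigr => i _; rewrite mxE mulrDl. Qed.

Lemma dotZl a u w : dot (a *: u) w = a * dot u w.
Proof. by rewrite mulr_sumr; apply: eq_bigr => i _; rewrite mxE mulrA. Qed.

Lemma dotNl u w : dot (- u) w = - dot u w.
Proof. by rewrite -scaleN1r dotZl mulN1r. Qed.

Lemma dotDr u v w : dot w (u + v) = dot w u + dot w v.
Proof. by rewrite dotC dotDl !(dotC w). Qed.

Lemma dotZr a u w : dot w (a *: u) = a * dot w u.
Proof. by rewrite dotC dotZl dotC. Qed.

Lemma dotNr u w : dot w (- u) = - dot w u.
Proof. by rewrite dotC dotNl dotC. Qed.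

Definition dotE := (dotDl, dotDr, dotNl, dotNr, dotZl, dotZr).

Lemma dot0l u : dot 0 u = 0.
Proof. by rewrite -(scale0r 0) dotZl mul0r. Qed.

Lemma dot_ge0 u : 0 <= dot u u.
Proof. by apply: sumr_ge0 => i _; rewrite -expr2 sqr_ge0. Qed.

Lemma enorm_ge0 u : 0 <= enorm u.
Proof. exact: sqrtr_ge0. Qed.

Lemma sqr_enorm u : enorm u ^+ 2 = dot u u.
Proof. by rewrite sqr_sqrtr // dot_ge0. Qed.

Lemma enorm0 : enorm (0 : 'rV[R]_n) = 0.
Proof. by rewrite /enorm dot0l sqrtr0. Qed.

Lemma enormN u : enorm (- u) = enorm u.
Proof. by rewrite /enorm !dotE opprK. Qed.

Lemma enorm_distC u v : enorm (u - v) = enorm (v - u).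
Proof. by rewrite -opprB enormN. Qed.

Lemma enormZ a u : enorm (a *: u) = `|a| * enorm u.
Proof.
by rewrite /enorm !dotE mulrA -expr2 sqrtrM ?sqr_ge0 // sqrtr_sqr.
Qed.

Lemma enorm_eq0 u : enorm u = 0 -> u = 0.
Proof.
move=> u0; have /eqP : dot u u = 0 by rewrite -sqr_enorm u0 expr0n.
rewrite psumr_eq0 => [/allP H|i _]; last by rewrite -expr2 sqr_ge0.
apply/rowP => i; rewrite mxE; apply/eqP.
by have := H i (mem_index_enum _); rewrite mulf_eq0 orbb.
Qed.

(** Cauchy-Schwarz, read off from the nonnegative square of [dot v v *: u - dot u v *: v]; [v = 0]
    is set apart because [dot v v] is divided out. *)
Lemma dot_le_enorm u v : dot u v <= enorm u * enorm v.
Proof.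
have CS : dot u v ^+ 2 <= (enorm u * enorm v) ^+ 2.
  rewrite exprMn !sqr_enorm.
  have [v0|v0] := eqVneq (dot v v) 0.
    have -> : v = 0 by apply: enorm_eq0; rewrite /enorm v0 sqrtr0.
    by rewrite dotC !dot0l mulr0 expr0n.
  have vp : 0 < dot v v by rewrite lt_neqAle eq_sym v0 dot_ge0.
  have := dot_ge0 (dot v v *: u - dot u v *: v).
  rewrite !dotE !(dotC v u) => H; rewrite -(ler_pM2l vp).
  by move: (dot u u) (dot v v) (dot u v) H => a b c; nra.
apply: le_trans (ler_norm _) _; rewrite -ler_sqr ?nnegrE //.
  by rewrite real_normK ?num_real.
by rewrite mulr_ge0 ?enorm_ge0.
Qed.

Lemma ler_enormD u v : enorm (u + v) <= enorm u + enorm v.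
Proof.
rewrite -ler_sqr ?nnegrE ?addr_ge0 ?enorm_ge0 // sqrrD !sqr_enorm !dotE (dotC v).
have := dot_le_enorm u v; rewrite -mulr_natr; lra.
Qed.

Lemma ler_enorm_dist u v w : enorm (u - w) <= enorm (u - v) + enorm (v - w).
Proof. by rewrite (le_trans _ (ler_enormD _ _)) // addrA subrK. Qed.

Lemma le_norm_enorm u : `|u| <= enorm u.
Proof.
rewrite [leLHS]/Num.Def.normr/= mx_normrE (bigmax_le _ (enorm_ge0 _))//= => -[i j] _ /=.
rewrite -sqrtr_sqr ler_wsqrtr // (ord1 i) /dot (bigD1 j) //= -expr2 lerDl.
by apply: sumr_ge0 => k _; rewrite -expr2 sqr_ge0.
Qed.

Lemma le_enorm_norm u : enorm u <= n%:R * `|u|.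
Proof.
have le1 i : `|u 0 i| <= `|u|.
  rewrite [leRHS]/Num.Def.normr/= mx_normrE.
  by apply: (le_bigmax _ (fun ij => `|u ij.1 ij.2|) (0, i)).
rewrite -[leRHS]ger0_norm ?mulr_ge0 // -sqrtr_sqr ler_wsqrtr //.
apply: (@le_trans _ _ (\sum_(i < n) `|u| ^+ 2)).
  apply: ler_sum => i _; rewrite -expr2 -real_normK ?num_real //.
  by rewrite ler_sqr ?nnegrE.
rewrite sumr_const card_ord exprMn -[leLHS]mulr_natl ler_wpM2r ?sqr_ge0 //.
by rewrite -natrX ler_nat -mulnn; case: (n) => // m; rewrite leq_pmulr.
Qed.

Lemma nbhs_enormP x (V : set 'rV[R]_n) :
  nbhs x V <-> exists2 e : R, 0 < e & forall y, enorm (y - x) < e -> V y.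
Proof.
split=> [/nbhs_ballP[e /= e0 eV]|[e e0 eV]].
  exists e => // y yx; apply: eV; rewrite -ball_normE /=.
  by rewrite (le_lt_trans (le_norm_enorm _)) // enorm_distC.
(* Dividing by [n.+1] rather than [n] keeps the radius positive when [n = 0]. *)
apply/nbhs_ballP; exists (e / n.+1%:R) => [|y]; rewrite /= ?divr_gt0 //.
rewrite -ball_normE /= ltr_pdivlMr // => yx; apply: eV.
rewrite enorm_distC (le_lt_trans (le_enorm_norm _)) // (le_lt_trans _ yx) //.
by rewrite mulrC ler_wpM2l // ler_nat.
Qed.

Lemma cvg_enormP (u_ : nat -> 'rV[R]_n) x : u_ @ \oo --> x <->
  forall e : R, 0 < e -> exists N, forall k, (N <= k)%N -> enorm (u_ k - x) < e.
Proof.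
split=> [ux e e0|H].
  have [|N _ NP] := ux [set y | enorm (y - x) < e].
    by apply/nbhs_enormP; exists e.
  by exists N => k /NP.
move=> V /nbhs_enormP[e /H[N NP] eV]; exists N => // k /= /NP; exact: eV.
Qed.

Lemma cluster_enormP (u_ : nat -> 'rV[R]_n) x : cluster (u_ @ \oo) x ->
  forall (e : R) N, 0 < e -> exists2 k, (N <= k)%N & enorm (u_ k - x) < e.
Proof.
move=> ux e N e0.
have [||y [[k Nk <-] yx]] := ux [set u_ k | k in [set k | (N <= k)%N]]
    [set y | enorm (y - x) < e].
- by exists N => // k Nk; exists k.
- by apply/nbhs_enormP; exists e.
by exists k.
Qed.

Lemma bounded_cluster (u_ : nat -> 'rV[R]_n) (B : R) :
  (forall k, enorm (u_ k) <= B) -> exists x, cluster (u_ @ \oo) x.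
Proof.
move=> uB.
have cK : compact [set x : 'rV[R]_n | `|x| <= B].
  apply: bounded_closed_compact.
    by exists B; split; [exact: num_real|move=> M BM y /= /le_trans; apply; exact: ltW].
  apply: (@preimage_closed _ _ (fun x : 'rV[R]_n => `|x|) [set r | r <= B]).
    by move=> ? _; exact: norm_continuous.
  exact: closed_le.
have [|x [_ ?]] := cK (u_ @ \oo); last by exists x.
by exists 0%N => // k _ /=; exact: le_trans (le_norm_enorm _) (uB k).
Qed.

End EuclideanTheory.

(** * Distance to a convex hull *)

Section ConvexHull.
Context {R : realType} {n : nat}.
Implicit Types (A : set 'rV[R]_n) (v w p : 'rV[R]_n).

Lemma sub_conv_hull A v : A v -> conv_hull A v.
Proof.
move=> Av; exists 1%N, (fun=> 1), (fun=> v); split => //.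
- by rewrite big_ord1.
- by rewrite big_ord1 scale1r.
Qed.

Lemma conv_hull_mono A (A' : set 'rV[R]_n) :
  A `<=` A' -> conv_hull A `<=` conv_hull A'.
Proof.
by move=> AA' v [m [a [w [a0 a1 wA ->]]]]; exists m, a, w; split=> // i; exact: AA'.
Qed.

Lemma conv_hull_comb A v w (s : R) : 0 <= s <= 1 -> conv_hull A v -> A w ->
  conv_hull A ((1 - s) *: v + s *: w).
Proof.
move=> /andP[s0 s1] [m [a [u [a0 a1 uA ->]]]] wA.
exists m.+1, (fun i => if unlift ord0 i is Some j then (1 - s) * a j else s).
exists (fun i => if unlift ord0 i is Some j then u j else w); split.
- by move=> i; case: unliftP => [j _|_] //; rewrite mulr_ge0 ?subr_ge0.
- rewrite big_ord_recl unlift_none; under eq_bigr do rewrite liftK.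
  by rewrite -mulr_sumr a1 mulr1 addrC subrK.
- by move=> i; case: unliftP.
rewrite big_ord_recl unlift_none; under [in RHS]eq_bigr do rewrite liftK.
rewrite scaler_sumr [LHS]addrC; congr (_ + _).
by apply: eq_bigr => i _; rewrite scalerA.
Qed.

Lemma enorm_conv_hull_le A (B : R) v : (forall w, A w -> enorm w <= B) ->
  conv_hull A v -> enorm v <= B.
Proof.
move=> AB [m [a [u [a0 a1 uA ->]]]].
have : forall i, enorm (a i *: u i) <= a i * B.
  by move=> i; rewrite enormZ ger0_norm // ler_wpM2l ?AB.
move=> H; apply: (@le_trans _ _ (\sum_i a i * B)); last first.
  by rewrite -mulr_suml a1 mul1r.
elim/big_ind2 : _ => // [|x1 x2 y1 y2 h1 h2]; first by rewrite enorm0.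
by rewrite (le_trans (ler_enormD _ _)) // lerD.
Qed.

(* Otherwise an almost shortest element [v] of the hull could be shortened by
   moving towards the [w] provided by the hypothesis for the direction [v]. *)
Lemma dist0_conv_hull_le A p (B : R) :
  (forall e, exists w, [/\ A w, enorm w <= B & dot w e <= dot p e]) ->
  (dist0 (conv_hull A) <= (enorm p)%:E)%E.
Proof.
move=> H; pose A' := A `&` [set w | enorm w <= B].
pose S := [set dot v v | v in conv_hull A'].
have S0 : S !=set0.
  have [w [Aw wB _]] := H 0; exists (dot w w); exists w => //.
  exact: sub_conv_hull.
have Slb : has_lbound S by exists 0 => _ [v _ <-]; exact: dot_ge0.
have leS v : conv_hull A' v -> inf S <= dot v v.
  by move=> Av; apply: ge_inf => //; exists v.
have inf_le : inf S <= dot p p.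
  rewrite leNgt; apply/negP => pS; pose k := inf S - dot p p.
  have k0 : 0 < k by rewrite subr_gt0.
  (* On the segment from [v] to [w] the squared norm at parameter [s] is at most
     [dot v v - s * k + 4 * B ^+ 2 * s ^+ 2]; this choice keeps the last term below half of the gain
     [s * k]. *)
  have [s [s0 s1 sB]] : exists s, [/\ 0 < s, s <= 1 & 8 * B ^+ 2 * s <= k].
    pose C := 8 * B ^+ 2 + k.
    have Ck : k <= C by rewrite lerDr mulr_ge0 ?sqr_ge0.
    have C0 : 0 < C := lt_le_trans k0 Ck.
    exists (k / C); split; first by rewrite divr_gt0.
      by rewrite ler_pdivrMr // mul1r.
    by rewrite mulrA ler_pdivrMr // mulrC ler_pM2l // lerDl ltW.
  have [||_ [v Av <-] vlt] := @inf_adherent _ S (s * k / 4).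
  - by apply: divr_gt0 => //; exact: mulr_gt0.
  - by split.
  have [w [Aw wB wv]] := H v.
  have vB : enorm v <= B by apply: (enorm_conv_hull_le _ Av) => ? [].
  have := leS _ (@conv_hull_comb A' v w s _ Av (conj Aw wB)).
  rewrite (ltW s0) s1 => /(_ isT).
  have pv := dot_ge0 (p - v); have vw := dot_ge0 (v + w).
  have vvB : dot v v <= B ^+ 2.
    by rewrite -sqr_enorm ler_sqr ?nnegrE ?enorm_ge0 // (le_trans (enorm_ge0 v)).
  have wwB : dot w w <= B ^+ 2.
    by rewrite -sqr_enorm ler_sqr ?nnegrE ?enorm_ge0 // (le_trans (enorm_ge0 v)).
  have iv := leS _ Av.
  move: pv vw; rewrite !dotE (dotC v p) (dotC v w) /k in vlt sB *.
  move: wv vvB wwB vlt sB iv pS; rewrite /k.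
  move: (dot w v) (dot p v) (dot v v) (dot w w) (dot p p) (inf S) (B ^+ 2).
  move=> wv pv vv ww pp m b wpv vb wb vm sb mv pm pv0 vw0 ms.
  have h1 : s * (pp + vv - 2 * wv) >= 0 by rewrite mulr_ge0 ?(ltW s0) //; lra.
  have h2 : s * s * (4 * b - (vv + ww - 2 * wv)) >= 0.
    by rewrite !mulr_ge0 ?(ltW s0) //; lra.
  have h3 : s * (m - pp - 8 * b * s) >= 0 by rewrite mulr_ge0 ?(ltW s0) //; lra.
  have h4 : s * (vv - m) >= 0 by rewrite mulr_ge0 ?(ltW s0) //; lra.
  have h5 : s * (m - pp) > 0 by rewrite mulr_gt0 //; lra.
  lra.
apply/lee_addgt0Pr => e e0.
have [||_ [v Av <-] vlt] := @inf_adherent _ S ((enorm p + e) ^+ 2 - inf S).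
- rewrite subr_gt0 (le_lt_trans inf_le) // -sqr_enorm ltr_sqr ?nnegrE
    ?enorm_ge0 ?addr_ge0 ?enorm_ge0 ?(ltW e0) //.
  by rewrite ltrDl.
- by split.
apply: (@le_trans _ _ (enorm v)%:E).
  by apply: ereal_inf_lbound; exists v => //; apply: conv_hull_mono Av => ? [].
rewrite -EFinD lee_fin -ler_sqr ?nnegrE ?enorm_ge0 ?addr_ge0 ?enorm_ge0 ?(ltW e0) //.
by rewrite sqr_enorm ltW // (lt_le_trans vlt) // addrC subrK.
Qed.

End ConvexHull.

(** * Lipschitz gradients and convex functions *)

Section Gradient.
Context {R : realType} {n : nat}.
Implicit Types (g : 'rV[R]_n -> R) (x y d : 'rV[R]_n).

Lemma derive_grad g x d : differentiable g x -> 'D_d g x = dot (grad g x) d.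
Proof.
move=> dg; rewrite deriveE // [d in LHS]row_sum_delta linear_sum.
by apply: eq_bigr => i _; rewrite linearZ /= mxE deriveE // mulrC.
Qed.

Lemma is_derive_line g x d (s : R) : differentiable g (x + s *: d) ->
  is_derive s 1 (fun r => g (x + r *: d)) (dot (grad g (x + s *: d)) d).
Proof.
move=> dg; have E : (fun h : R => h^-1 *: (g (x + (h *: 1 + s) *: d) - g (x + s *: d)))
    = (fun h : R => h^-1 *: (g (h *: d + (x + s *: d)) - g (x + s *: d))).
  apply/funext => h; congr (_ *: (g _ - _)).
  by rewrite [h *: 1]mulr1 scalerDl addrCA.
split; first by rewrite /derivable E; exact: diff_derivable.
by rewrite /derive E -derive_grad.
Qed.

(** For either sign [e], the function [F] below has nonpositive derivative on the unit interval, by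
    Cauchy-Schwarz and the Lipschitz bound, so the mean value theorem gives [F 1 <= F 0]. *)
Lemma dist_taylor_le (L : R) g x y : lipschitz_gradient L g ->
  `|g y - g x - dot (grad g x) (y - x)| <= L / 2 * enorm (y - x) ^+ 2.
Proof.
move=> [L0 dg lg]; set d := y - x; pose D := enorm d ^+ 2.
suff H (e : R) : `|e| = 1 ->
    e * (g y - g x - dot (grad g x) d) <= L / 2 * D.
  rewrite ler_norml lerNl -mulN1r H ?normrN1 //= -[X in X <= _]mul1r H //.
  exact: normr1.
move=> e1.
pose F r := e * (g (x + r *: d) - r * dot (grad g x) d) - r * r * (L / 2 * D).
pose dF r := e * (dot (grad g (x + r *: d)) d - dot (grad g x) d) - r * L * D.
have FD (r : R) : is_derive r 1 F (dF r).
  have := is_derive_line (dg (x + r *: d)) => Hl.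
  have HF := @is_deriveB _ _ _ _ _ _ _ _ _
    (is_deriveZ e (is_deriveB Hl (is_deriveM (is_derive_id r 1)
      (is_derive_cst (dot (grad g x) d) r 1))))
    (is_deriveM (is_deriveM (is_derive_id r 1) (is_derive_id r 1)) (is_derive_cst (L / 2 * D) r 1)).
  apply: (@is_derive_eq _ _ _ F r 1 (dF r) _ HF).
  rewrite /dF /= /GRing.scale /=; lra.
have Fc : {within `[0, 1], continuous F}.
  apply: continuous_subspaceT => r; apply: differentiable_continuous.
  by apply/derivable1_diffP; exact: (@ex_derive _ _ _ _ _ _ _ (FD r)).
have [c /[!in_itv]/= /andP[c0 _]] := MVT_segment ler01 (fun r _ => FD r) Fc.
rewrite subr0 mulr1 /F scale0r addr0 scale1r !(mul0r, mul1r, subr0).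
have -> : x + d = y by rewrite addrC subrK.
move=> E.
have : dF c <= 0.
  rewrite subr_le0 (le_trans (ler_norm _)) // normrM e1 mul1r -dotNl -dotDl.
  set z := grad g _ - _.
  have lez : enorm z <= c * L * enorm d.
    by rewrite (le_trans (lg _ _)) // addrAC subrr add0r enormZ ger0_norm // mulrCA mulrA.
  rewrite /D expr2 mulrA ler_norml lerNl -dotNl !(le_trans (dot_le_enorm _ _)) //.
    by rewrite ler_wpM2r ?enorm_ge0.
  by rewrite enormN ler_wpM2r ?enorm_ge0.
rewrite -E; lra.
Qed.

Lemma lipschitz_gradient_continuous (L : R) g :
  lipschitz_gradient L g -> continuous g.
Proof. by move=> [_ dg _] x; exact: differentiable_continuous. Qed.

End Gradient.

Section ConvexAnalysis.
Context {R : realType} {n : nat}.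
Implicit Types (h : 'rV[R]_n -> R) (x y d u v w : 'rV[R]_n).

Lemma convex_funP h x y (s : R) : convex_fun h -> 0 <= s <= 1 ->
  h (s *: x + (1 - s) *: y) <= s * h x + (1 - s) * h y.
Proof. by move=> hc /andP[s0 s1]; exact: (hc (Itv01 s0 s1) x y (in_setT _) (in_setT _)). Qed.

Lemma small_scale (a b e : R) : 0 < e ->
  exists s, [/\ 0 < s, s * a < e & s * b < e].
Proof.
move=> e0; exists (e / (1 + `|a| + `|b|)).
have [a0 b0] : 0 <= `|a| /\ 0 <= `|b| by [].
have [na nb] := (ler_norm a, ler_norm b).
have M0 : 0 < 1 + `|a| + `|b| by lra.
split; first by rewrite divr_gt0.
  by rewrite mulrAC ltr_pdivrMr // ltr_pM2l //; lra.
by rewrite mulrAC ltr_pdivrMr // ltr_pM2l //; lra.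
Qed.

(** The upper bound at the reflected point [2 *: x - y], fed into convexity at the midpoint [x],
    bounds [h y] from below. *)
Lemma convex_usc_continuous h : convex_fun h ->
  (forall x (e : R), 0 < e ->
     exists2 r : R, 0 < r & forall y, enorm (y - x) < r -> h y < h x + e) ->
  forall x (e : R), 0 < e ->
    exists2 r : R, 0 < r & forall y, enorm (y - x) < r -> `|h y - h x| < e.
Proof.
move=> hc husc x e e0; have [r r0 rP] := husc x e e0; exists r => // y yx.
have mid : h x <= 2^-1 * h y + 2^-1 * h (2 *: x - y).
  have := @convex_funP h y (2 *: x - y) 2^-1 hc.
  rewrite (_ : 1 - 2^-1 = 2^-1); last lra.
  have -> : 2^-1 *: y + 2^-1 *: (2 *: x - y) = x.
    by apply/rowP => i; rewrite !mxE; lra.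
  apply.
  by rewrite invr_ge0 ler0n /=; lra.
have xy : 2 *: x - y - x = x - y by apply/rowP => i; rewrite !mxE; ring.
have := rP (2 *: x - y); rewrite xy enorm_distC => /(_ yx) h1.
have h2 := rP y yx.
by rewrite ltr_norml; apply/andP; split; lra.
Qed.

Lemma subdiff_monotone h x y v w : subdiff h x v -> subdiff h y w ->
  0 <= dot (w - v) (y - x).
Proof.
move=> /(_ y) + /(_ x); rewrite -(opprB y x) !dotE; lra.
Qed.

(** A subgradient [w] at [u] is tested at [u + d], with [d] of length [r / 2] along [w]: then
    [r / 2 * enorm w] is at most an oscillation of [h], which is less than 2. *)
Lemma subdiff_locally_bounded h x :
  (exists2 r : R, 0 < r & forall y, enorm (y - x) < r -> `|h y - h x| < 1) ->
  exists r B, [/\ 0 < r, 0 < B &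
    forall u w, enorm (u - x) < r -> subdiff h u w -> enorm w <= B].
Proof.
move=> [r r0 hr]; exists (r / 2), (4 / r); split; rewrite ?divr_gt0 // => u w ux hw.
have [->|w0] := eqVneq (enorm w) 0; first by rewrite divr_ge0 // ltW.
have wp : 0 < enorm w by rewrite lt_neqAle eq_sym w0 enorm_ge0.
pose d := (r / 2 / enorm w) *: w.
have dr : enorm d = r / 2.
  by rewrite enormZ ger0_norm ?divr_ge0 ?enorm_ge0 ?ltW ?divr_gt0 // divfK.
have := hw (u + d); rewrite [X in dot w X]addrC addKr => hd.
have : `|h (u + d) - h x| < 1.
  by apply: hr; rewrite addrAC (le_lt_trans (ler_enormD _ _)) // dr; lra.
have : `|h u - h x| < 1 by apply: hr; lra.
rewrite !ltr_norml => /andP[h1 h2] /andP[h3 h4].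
have : dot w d = r / 2 * enorm w.
  by rewrite dotZr -sqr_enorm expr2 mulrA divfK.
rewrite ler_pdivlMr // => E; lra.
Qed.

(** Since [u] is a convex combination of [y] and [u - s *: d], the quadratic upper bound at the
    latter point bounds [h y] from below; after division by [s] its error is of order [s]. *)
Lemma subdiff_of_quadratic_upper h u w (c e : R) : convex_fun h -> 0 < e ->
  (forall y, enorm (y - u) < e ->
     h y <= h u + dot w (y - u) + c * enorm (y - u) ^+ 2) ->
  subdiff h u w.
Proof.
move=> hc e0 H y; set d := y - u.
have le_s (s : R) : 0 < s -> s * enorm d < e ->
    dot w d <= h y - h u + s * (c * enorm d ^+ 2).
  move=> s0 sd.
  have := H (u - s *: d); rewrite addrC addKr enormN enormZ gtr0_norm // => /(_ sd).
  have s1 : 0 < 1 + s by lra.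
  have := @convex_funP h y (u - s *: d) (s / (1 + s)) hc.
  have E : 1 - s / (1 + s) = (1 + s)^-1 by field; lra.
  have -> : (s / (1 + s)) *: y + (1 - s / (1 + s)) *: (u - s *: d) = u.
    by apply/rowP => i; rewrite !mxE; field; lra.
  rewrite E => /(_ _)/[swap] hu.
  have s01 : 0 <= s / (1 + s) <= 1.
    by rewrite divr_ge0 ?ler_pdivrMr ?mul1r; lra.
  move=> /(_ s01) hs.
  have : (1 + s) * h u <= s * h y + h (u - s *: d).
    rewrite (_ : s * h y + _ = (1 + s) * (s / (1 + s) * h y +
      (1 + s)^-1 * h (u - s *: d))); last by field; lra.
    by rewrite ler_pM2l.
  move: hu; rewrite dotNr dotZr exprMn => hu hv.
  rewrite -(ler_pM2l s0); lra.
apply/ler_addgt0Pr => eps eps0.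
have [|s [s0 sd sc]] := @small_scale (enorm d) (c * enorm d ^+ 2) (Num.min e eps).
  by rewrite lt_min e0.
have := le_s s s0; move: sd sc; rewrite !lt_min => /andP[sd _] /andP[_ sc].
move=> /(_ sd); lra.
Qed.

End ConvexAnalysis.

(** * Frechet, limiting and Clarke subgradients *)

Section Subgradients.
Context {R : realType} {n : nat}.
Implicit Types (psi : 'rV[R]_n -> \bar R) (F g h : 'rV[R]_n -> R).
Implicit Types (x y d u v w : 'rV[R]_n).

(** Testing [v] at [x + s *: d] for [d = v - grad h x] against the Taylor bound shows that
    [enorm d ^+ 2] is of order [s] for arbitrarily small [s]. *)
Lemma subdiff_grad (L : R) h x v :
  lipschitz_gradient L h -> subdiff h x v -> v = grad h x.
Proof.
move=> lh hv; apply/eqP; rewrite -subr_eq0; set d := v - _; apply/eqP/enorm_eq0.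
apply/eqP; rewrite -sqrf_eq0 eq_le sqr_ge0 andbT; apply/ler_addgt0Pr => e e0.
have [s [s0 _ se]] := small_scale 0 (L / 2 * enorm d ^+ 2) e0.
have := hv (x + s *: d); rewrite [X in dot v X]addrC addKr => h1.
have := dist_taylor_le x (x + s *: d) lh.
rewrite [x + s *: d - x]addrC addKr enormZ [`|s|]gtr0_norm // exprMn ler_norml => /andP[_ h2].
rewrite -(ler_pM2l s0) {1}sqr_enorm {1}/d dotDl dotNl.
rewrite !dotZr in h1 h2; move: (ltW se); rewrite -(ler_pM2l s0) add0r; lra.
Qed.

(** Proximal subgradients are Frechet subgradients: near [x] the difference quotient is at least
    [- c * enorm (y - x)], which tends to 0. *)
Lemma frechet_of_quadratic_lower psi x v (c e : R) :
  0 < e -> 0 <= c -> psi x \is a fin_num ->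
  (forall y, enorm (y - x) < e ->
     (psi x + (dot v (y - x) - c * enorm (y - x) ^+ 2)%:E <= psi y)%E) ->
  frechet_subdiff psi x v.
Proof.
move=> e0 c0 /fineK; set r := fine _ => xr H.
split; first by rewrite /edom /= -xr ltry.
rewrite limf_einfE; apply/lee_subgt0Pr => eps eps0.
have [s [s0 _ sc]] := small_scale 0 c eps0.
pose V := [set y | y != x /\ enorm (y - x) < Num.min e s].
have VP : x^' V.
  apply/nbhs_enormP; exists (Num.min e s); first by rewrite lt_min e0.
  by move=> y yx /= ynx; split.
rewrite sub0e -EFinN.
apply: le_trans (ereal_sup_ubound _) => /=; last by exists V => //; reflexivity.
apply: le_ereal_inf_tmp => _ [y [ynx yV] <-].
move: yV; rewrite lt_min => /andP[ye ys].
have yp : 0 < enorm (y - x).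
  rewrite lt_neqAle enorm_ge0 andbT eq_sym; apply: contra ynx => /eqP /enorm_eq0 /eqP.
  by rewrite subr_eq0.
have := H y ye; rewrite -xr; case: (psi y) => [p| |] //=.
  rewrite -EFinD -!EFinB -EFinM !lee_fin => Hp.
  rewrite -[leLHS](mulfK (lt0r_neq0 yp)) ler_pM2r ?invr_gt0 //.
  have : c * enorm (y - x) ^+ 2 <= eps * enorm (y - x).
    rewrite expr2 mulrA ler_pM2r // (le_trans _ (ltW sc)) // mulrC.
    by rewrite ler_wpM2r // ltW.
  lra.
by move=> _; rewrite gt0_mulye ?lte_fin ?invr_gt0 // leey.
Qed.

Lemma frechet_limiting psi x v : frechet_subdiff psi x v -> limiting_subdiff psi x v.
Proof.
move=> H; split; first by case: H.
exists (cst x), (cst v); split => //; [exact: cvg_cst|exact: (@cvg_cst _ (psi x))|exact: cvg_cst].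
Qed.

(** Continuity of [F] makes the convergence of values automatic, so approximations with errors below
    [k.+1%:R^-1] form the required sequences. *)
Lemma limiting_of_approx F x v : {for x, continuous F} ->
  (forall e : R, 0 < e -> exists u w, [/\ enorm (u - x) < e, enorm (w - v) < e &
     frechet_subdiff (EFin \o F) u w]) ->
  limiting_subdiff (EFin \o F) x v.
Proof.
move=> Fc H; split; first by rewrite /edom /= ltry.
have /choice[q qP] (k : nat) : exists q : 'rV[R]_n * 'rV[R]_n,
    [/\ enorm (q.1 - x) < k.+1%:R^-1, enorm (q.2 - v) < k.+1%:R^-1 &
       frechet_subdiff (EFin \o F) q.1 q.2].
  by have [|u [w Hk]] := H (k.+1%:R^-1); [rewrite invr_gt0|exists (u, w)].
have arch (e : R) : 0 < e -> exists N, forall k, (N <= k)%N -> k.+1%:R^-1 < e.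
  move=> e0; have [N _ NP] := near_infty_natSinv_lt (PosNum e0).
  by exists N => k /NP.
have qx : (fst \o q) @ \oo --> x.
  apply/cvg_enormP => e /arch[N NP]; exists N => k /NP.
  by apply: lt_trans; case: (qP k).
exists (fst \o q), (snd \o q); split => //.
- apply: cvg_EFin; first exact: nearW.
  exact: (@continuous_cvg _ _ _ _ _ (fst \o q) F x Fc).
- by move=> k; case: (qP k).
apply/cvg_enormP => e /arch[N NP]; exists N => k /NP.
by apply: lt_trans; case: (qP k).
Qed.

Lemma continuous_enormP F x : {for x, continuous F} <->
  forall e : R, 0 < e ->
    exists2 r : R, 0 < r & forall y, enorm (y - x) < r -> `|F y - F x| < e.
Proof.
split=> [Fx e e0|H].
  have /nbhs_enormP := Fx _ (nbhsx_ballx (F x) e e0).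
  by move=> [r r0 rP]; exists r => // y /rP; rewrite /= distrC.
move=> V /nbhs_ballP[e /= /H[r r0 rP] eV].
by apply/nbhs_enormP; exists r => // y /rP yx; apply: eV; rewrite /ball /= distrC.
Qed.

Lemma nonexpansive_continuous F :
  (forall y z, F y - F z <= enorm (y - z)) -> continuous F.
Proof.
move=> H x; apply/continuous_enormP => e e0; exists e => // y; apply: le_lt_trans.
by rewrite ler_norml lerNl opprB [in X in X && _]enorm_distC !H.
Qed.

(** A minimizer [u] of [F] plus a steep quadratic penalty over a small compact ball around [x] is
    interior; minimality then reads as a quadratic lower bound of [F] at [u]. *)
Lemma proximal_subgradient_dense F x (e : R) : continuous F -> 0 < e ->
  exists u v c r, [/\ enorm (u - x) < e, 0 <= c, 0 < r &
    forall y, enorm (y - u) < r ->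
      F u + dot v (y - u) - c * enorm (y - u) ^+ 2 <= F y].
Proof.
move=> Fc e0.
have [r r0 rP] := (continuous_enormP F x).1 (Fc x) 1 ltr01.
pose m := Num.min e r; have m0 : 0 < m by rewrite lt_min e0.
have [N0 N1] : 0 < n.+1%:R :> R /\ 1 <= n.+1%:R :> R by rewrite ltr0n ler1n.
(* [K] is a ball of the sup norm; the factor [n.+1] keeps it inside the Euclidean ball of radius
   [m]. *)
pose D := m / n.+1%:R / 2; have D0 : 0 < D by rewrite !divr_gt0.
have Dm : D < m by rewrite /D ltr_pdivrMr // ltr_pdivrMr //; nra.
pose K := [set y | `|y - x| <= D].
have xK : K x by rewrite /K /= subrr normr0 ltW.
have KE y : K y -> enorm (y - x) < m.
  move=> yK; rewrite (le_lt_trans (le_enorm_norm _)) //.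
  apply: (@le_lt_trans _ _ (n.+1%:R * D)); first by apply: ler_pM => //; rewrite ler_nat leqnSn.
  rewrite (_ : n.+1%:R * D = m / 2); last by rewrite /D; field; lra.
  by rewrite ltr_pdivrMr // ltr_pMr // ltr1n.
have cK : compact K.
  apply: bounded_closed_compact.
    exists (D + `|x|); split; first exact: num_real.
    move=> M DM y yK /=; rewrite -[y](subrK x) (le_trans (ler_normD _ _)) //.
    by apply: ltW; apply: le_lt_trans DM; rewrite lerD.
  apply: (@preimage_closed _ _ (fun y : 'rV[R]_n => `|y - x|) [set s | s <= D]).
    move=> y _; apply: nonexpansive_continuous => {}y z.
    rewrite (le_trans (lerB_dist _ _)) // opprB addrA subrK.
    exact: le_norm_enorm.
  exact: closed_le.
(* On [K] the values of [F] differ from [F x] by less than 1, so minimality gives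
   [l * enorm (u - x) ^+ 2 < 1], hence [enorm (u - x) < D]. *)
pose l := 2 / D ^+ 2; have l0 : 0 < l by rewrite divr_gt0 ?exprn_gt0.
pose G y := F y + l * enorm (y - x) ^+ 2.
have Gc : {within K, continuous G}.
  have Ec : continuous (fun y => enorm (y - x)).
    by apply: nonexpansive_continuous => y z; rewrite lerBlDr ler_enorm_dist.
  apply: continuous_subspaceT => y.
  apply: (@continuousD _ _ _ F (fun y => l * enorm (y - x) ^+ 2)); first exact: Fc.
  apply: (@continuousM _ _ (cst l) (fun y => enorm (y - x) ^+ 2)).
    exact: cst_continuous.
  exact: (continuousM (Ec y) (Ec y)).
have [u /set_mem uK umin] := EVT_min_rV (ex_intro _ x xK) cK Gc.
have ux : enorm (u - x) < D.
  have := umin x (mem_set xK); rewrite /G subrr enorm0 expr0n mulr0 addr0 => h1.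
  have := rP u (lt_le_trans (KE _ uK) _); rewrite ge_min lexx orbT => /(_ isT).
  rewrite ltr_norml => /andP[h2 h3].
  rewrite -ltr_sqr ?nnegrE ?enorm_ge0 ?(ltW D0) // -(ltr_pM2l l0) /l.
  rewrite mulfVK ?expf_neq0 ?lt0r_neq0 // -/l; lra.
exists u, ((- (2 * l)) *: (u - x)), l, (D - enorm (u - x)).
split; [|exact: ltW|by rewrite subr_gt0|].
  by rewrite (lt_le_trans (lt_trans ux Dm)) // ge_min lexx.
move=> y yu.
have yK : K y.
  rewrite /K /= (le_trans (le_norm_enorm _)) // (le_trans (ler_enorm_dist _ u _)) //; lra.
have := umin y (mem_set yK); rewrite /G.
have -> : y - x = (y - u) + (u - x) by rewrite addrA subrK.
move: (y - u) (u - x) => a b.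
rewrite !sqr_enorm !dotE (dotC b a); lra.
Qed.

End Subgradients.

(** * Clarke subgradients of a smooth function minus a convex one *)

Section ClarkeBound.
Context {R : realType} {n : nat}.
Variables (F g h : 'rV[R]_n -> R) (L : R).
Hypotheses (FE : forall x, F x = g x - h x) (lg : lipschitz_gradient L g)
  (hc : convex_fun h) (Flsc : lower_semicontinuous (EFin \o F)).

(** [h = g - F] is upper semicontinuous, as [g] is continuous and [F] lower semicontinuous;
    convexity then gives continuity. *)
Let hcont x (e : R) : 0 < e ->
  exists2 r : R, 0 < r & forall y, enorm (y - x) < r -> `|h y - h x| < e.
Proof.
apply: convex_usc_continuous => // {}x {}e e0; have e2 : 0 < e / 2 by rewrite divr_gt0.
have [|V /nbhs_enormP[r r0 rV] VP] := Flsc (x := x) (a := F x - e / 2).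
  by rewrite /= lte_fin; lra.
have [q q0 qP] := (continuous_enormP g x).1 (lipschitz_gradient_continuous lg (x := x)) _ e2.
exists (Num.min r q) => [|y]; first by rewrite lt_min r0.
rewrite lt_min => /andP[/rV/VP + /qP]; rewrite /= lte_fin !FE ltr_norml => + /andP[_].
lra.
Qed.

Lemma dc_continuous : continuous F.
Proof.
move=> x; rewrite (_ : F = g - h); last by apply/funext => y; rewrite FE.
apply: continuousB; first exact: lipschitz_gradient_continuous lg _.
by apply/continuous_enormP => e; exact: hcont.
Qed.

(* A proximal subgradient of [F] at a point [u] near [x + s *: e] gives a
   gradient of [h] at [u], and monotonicity of the subdifferential of [h]
   compares it with [p] along the direction [e]. *)
Lemma dc_limiting_direction x : exists B : R, forall p e, subdiff h x p ->
  exists v, [/\ limiting_subdiff (EFin \o F) x v, enorm v <= B &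
    dot v e <= dot (grad g x - p) e].
Proof.
have [r [B [r0 B0 hB]]] := subdiff_locally_bounded (hcont x ltr01).
have L0 : 0 <= L by case: lg.
(* The bound does not depend on the direction [e], as the estimate of the distance to the hull
   requires. *)
exists (enorm (grad g x) + L * r + B) => p e hp.
set BB := _ + B; pose a := enorm e + 1; pose M := L * a * enorm e + B + enorm p.
have a0 : 0 < a by rewrite ltr_wpDl ?enorm_ge0.
have step (s : R) : 0 < s -> s <= 1 -> s * a < r -> exists q : 'rV[R]_n * 'rV[R]_n,
    [/\ frechet_subdiff (EFin \o F) q.1 q.2, enorm (q.1 - x) <= s * a,
      enorm q.2 <= BB & dot q.2 e <= dot (grad g x - p) e + M * s].
  move=> s0 s1 sr.
  (* The distance [s * s] to [x + s *: e] leaves an error of order [s] after the monotonicity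
     inequality is divided by [s]. *)
  have [u [v [c [d [uxs c0 d0 Hv]]]]] :=
    proximal_subgradient_dense (x + s *: e) dc_continuous (mulr_gt0 s0 s0).
  have ux : enorm (u - x) <= s * a.
    have -> : u - x = (u - (x + s *: e)) + s *: e.
      by apply/rowP => i; rewrite !mxE; ring.
    rewrite (le_trans (ler_enormD _ _)) // enormZ gtr0_norm // /a mulrDr mulr1 addrC.
    by rewrite lerD2l (le_trans (ltW uxs)) // ler_piMl // ltW.
  have Fv : frechet_subdiff (EFin \o F) u v.
    apply: (frechet_of_quadratic_lower d0 c0) => // y /Hv.
    by rewrite /= -EFinD lee_fin addrA.
  (* Subtracting the quadratic lower bound for [F] from the Taylor upper bound for [g] bounds [h]
     above by a quadratic with slope [w]. *)
  pose w := grad g u - v.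
  have hw : subdiff h u w.
    apply: (@subdiff_of_quadratic_upper _ _ _ _ _ (c + L / 2) d) => // y /Hv.
    have := dist_taylor_le u y lg; rewrite ler_norml => /andP[_].
    rewrite !FE /w dotDl dotNl; lra.
  have vE : v = grad g u - w by rewrite /w opprB addrC subrK.
  clearbody w; have wB : enorm w <= B by apply: hB hw; apply: le_lt_trans sr.
  have gux : enorm (grad g u - grad g x) <= L * (s * a).
    case: lg => _ _ H; exact: le_trans (H _ _) (ler_wpM2l L0 ux).
  exists (u, v); split => //=.
    have -> : v = (grad g x + (grad g u - grad g x)) - w.
      by rewrite vE; apply/rowP => i; rewrite !mxE; ring.
    rewrite (le_trans (ler_enormD _ _)) // enormN lerD // (le_trans (ler_enormD _ _)) //.
    by rewrite lerD // (le_trans gux) // ler_wpM2l // ltW.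
  have mono : - (B + enorm p) * s <= dot (w - p) e.
    have := subdiff_monotone hp hw.
    have -> : u - x = s *: e + (u - (x + s *: e)).
      by apply/rowP => i; rewrite !mxE; ring.
    rewrite dotDr dotZr => h1.
    have h2 : dot (w - p) (u - (x + s *: e)) <= (B + enorm p) * (s * s).
      rewrite (le_trans (dot_le_enorm _ _)) // ler_pM ?enorm_ge0 ?(ltW uxs) //.
      by rewrite (le_trans (ler_enormD _ _)) // enormN lerD2r.
    rewrite -(ler_pM2l s0); lra.
  have gd : dot (grad g u - grad g x) e <= L * (s * a) * enorm e.
    by rewrite (le_trans (dot_le_enorm _ _)) // ler_wpM2r ?enorm_ge0.
  move: gd mono; rewrite vE /M !dotDl !dotNl; lra.
have [|s1 [s10]] := @small_scale _ a 1 (Num.min r 1); first by rewrite lt_min r0 ltr01.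
rewrite mulr1 !lt_min => /andP[s1a _] /andP[_ /ltW s11].
have sk k : 0 < s1 / k.+1%:R by rewrite divr_gt0.
have sk_le k : s1 / k.+1%:R <= s1 by rewrite ler_pdivrMr // ler_peMr ?(ltW s10) ?ler1n.
have /choice[q qP] k := step _ (sk k) (le_trans (sk_le k) s11)
  (le_lt_trans (ler_wpM2r (ltW a0) (sk_le k)) s1a).
(* Along the steps [s1 / k.+1%:R] the points tend to [x] and the subgradients stay bounded, so a
   cluster point of the latter is a limiting subgradient at [x]. *)
have [v vcl] : exists v, cluster (snd \o q @ \oo) v.
  by apply: (bounded_cluster (B := BB)) => k; case: (qP k).
have near_v (eps : R) : 0 < eps -> exists k, enorm ((q k).2 - v) < eps /\ s1 / k.+1%:R < eps.
  move=> eps0; have eps1 : 0 < eps / s1 by rewrite divr_gt0.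
  have [N _ NP] := near_infty_natSinv_lt (PosNum eps1).
  have [k Nk kv] := cluster_enormP vcl N eps0; exists k; split => //.
  by have := NP k Nk; rewrite /= ltr_pdivlMr // mulrC.
exists v; split.
- apply: limiting_of_approx; first exact: dc_continuous.
  move=> eps eps0; have [|k [kv ks]] := near_v (Num.min eps (eps / a)).
    by rewrite lt_min eps0 divr_gt0.
  have [fk kx _ _] := qP k; exists (q k).1, (q k).2; split => //.
    by rewrite (le_lt_trans kx) // -ltr_pdivlMr // (lt_le_trans ks) // ge_min lexx orbT.
  by rewrite (lt_le_trans kv) // ge_min lexx.
- apply/ler_addgt0Pr => eps /near_v[k [kv _]]; have [_ _ kB _] := qP k.
  rewrite -[v](subKr (q k).2) (le_trans (ler_enormD _ _)) // enormN lerD //.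
  exact: ltW.
apply/ler_addgt0Pr => eps eps0.
have M0 : 0 <= M by rewrite !addr_ge0 ?mulr_ge0 ?enorm_ge0 ?(ltW a0) ?(ltW B0).
have [d [d0 dM de]] := small_scale M (enorm e) (divr_gt0 eps0 (ltr0n R 2)).
have [k [kv ks]] := near_v d d0; have [_ _ _ ke] := qP k.
have : dot (v - (q k).2) e <= d * enorm e.
  rewrite (le_trans (dot_le_enorm _ _)) // ler_wpM2r ?enorm_ge0 // enorm_distC ltW //.
have : M * (s1 / k.+1%:R) <= d * M by rewrite mulrC ler_wpM2r // ltW.
rewrite [dot (v - _) e]dotDl dotNl; move: ke dM de.
move: (dot v e) (dot (q k).2 e) (dot _ e) (M * (s1 / _)) (d * M) (d * _).
by move=> *; lra.
Qed.

Lemma dist0_clarke_le x p : subdiff h x p ->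
  (dist0 (clarke_subdiff (EFin \o F) x) <= (enorm (grad g x - p))%:E)%E.
Proof.
move=> hp; have [B BP] := dc_limiting_direction x.
by apply: (dist0_conv_hull_le (B := B)) => e; exact: BP.
Qed.

End ClarkeBound.

(** * Decay of real sequences *)

Section Sequences.
Context {R : realType}.
Implicit Types (u w : nat -> R).

(** The sum [S] of the ratios below [N] absorbs the finitely many early indices. Index 0 is excluded
    because powers of [k%:R] with nonzero exponent vanish there. *)
Lemma eventually_le_scale u w (N : nat) (M : R) :
  (forall k, (1 <= k)%N -> 0 < w k) ->
  (forall k, (N <= k)%N -> u k <= M * w k) ->
  exists2 mu, 0 < mu & forall k, (1 <= k)%N -> u k <= mu * w k.
Proof.
move=> w0 H; pose S := \sum_(i < N) `|u i| / `|w i|.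
have S0 : 0 <= S by apply: sumr_ge0 => i _; rewrite divr_ge0.
exists (1 + `|M| + S) => [|k k1].
  by have := normr_ge0 M; lra.
have wk := w0 k k1; have [/H uk|kN] := leqP N k.
  rewrite (le_trans uk) // ler_pM2r //; have := ler_norm M; lra.
rewrite -ler_pdivrMr //.
have : `|u k| / `|w k| <= S.
  rewrite /S (bigD1 (Ordinal kN)) //= lerDl.
  by apply: sumr_ge0 => i _; rewrite divr_ge0.
rewrite [`|w k|]gtr0_norm // => uS; have := normr_ge0 M.
have : u k / w k <= `|u k| / w k by rewrite ler_pM2r ?invr_gt0 // ler_norm.
lra.
Qed.

(** The rate is [Num.sqrt l] because the recursion advances by two; [M] dominates the starting
    ratios of both parities. *)
Lemma two_step_linear_decay u (l : R) (N : nat) :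
  (forall k, 0 <= u k) -> 0 < l < 1 ->
  (forall k, (N <= k)%N -> u k.+2 <= l * u k) ->
  exists M q, [/\ 0 <= M, 0 < q < 1 & forall k, (N <= k)%N -> u k <= M * q ^+ k].
Proof.
move=> u0 /andP[l0 l1] H; pose q := Num.sqrt l.
have q0 : 0 < q by rewrite sqrtr_gt0.
have q2 : q ^+ 2 = l by rewrite sqr_sqrtr // ltW.
have q1 : q < 1 by rewrite -ltr_sqr ?nnegrE ?(ltW q0) // q2 expr1n.
have qk k : 0 < q ^+ k by rewrite exprn_gt0.
pose M := u N / q ^+ N + u N.+1 / q ^+ N.+1.
have [h1 h2] : 0 <= u N / q ^+ N /\ 0 <= u N.+1 / q ^+ N.+1.
  by split; rewrite divr_ge0 // ltW.
exists M, q; split; rewrite ?q0 ?q1 //; first by rewrite addr_ge0.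
suff P j : u (N + j)%N <= M * q ^+ (N + j) /\
           u (N + j).+1 <= M * q ^+ (N + j).+1.
  by move=> k Nk; rewrite -(subnKC Nk); case: (P (k - N)%N).
elim: j => [|j [IH1 IH2]].
  by rewrite addn0 -!ler_pdivrMr // /M; split; lra.
rewrite addnS; split => //; rewrite (le_trans (H _ _)) ?leq_addr //.
by rewrite -[(N + j).+2]addn2 exprD q2 mulrA [leRHS]mulrC ler_pM2l.
Qed.

(** The power is at most [expR (s * y)], and [1 - z <= expR (- z)] at [z = s * y] gives the rest. *)
Lemma powR_onePx_le (s y : R) : 0 <= s -> 0 <= y ->
  (1 + y) `^ s <= 1 + s * y * expR (s * y).
Proof.
move=> s0 y0; have y1 : 0 < 1 + y by lra.
have le_exp : (1 + y) `^ s <= expR (s * y).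
  rewrite /powR gt_eqF // ler_expR ler_wpM2l //.
  by apply: le_ln1Dx; lra.
rewrite (le_trans le_exp) //.
have := expR_ge1Dx (- (s * y)); rewrite expRN => h.
have := ler_wpM2r (expR_ge0 (s * y)) h.
rewrite mulVf ?gt_eqF ?expR_gt0 //; lra.
Qed.

(** Induction from [k] to [k.+2]. If [u k.+2] exceeded the claimed bound [v], the recursion would
    force a decrease from [u k] of at least [v * (A / K / k.+2%:R)], while the bound on [u k]
    exceeds [v] by no more than that. *)
Lemma two_step_sublinear_decay u (K p : R) (N : nat) :
  (forall k, 0 < u k) -> 0 < K -> 1 < p -> (1 <= N)%N ->
  (forall k, (N <= k)%N -> u k.+2 `^ p <= K * (u k - u k.+2)) ->
  exists2 M, 0 < M &
    forall k, (N <= k)%N -> u k <= M * k%:R `^ (- (p - 1)^-1).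
Proof.
move=> u0 K0 p1 N1 H; set s := (p - 1)^-1.
have s0 : 0 < s by rewrite invr_gt0; lra.
have sp : s * (p - 1) = 1 by rewrite mulVf //; lra.
(* The 6 comes from [2 / k <= 6 / (k + 2)] for [k >= 1], the exponential from [2 / k <= 2]. *)
pose A := 6 * s * expR (2 * s) * K.
have A0 : 0 < A by rewrite !mulr_gt0 // expR_gt0.
(* The first term makes the power [p - 1] of [M] at least [A]; the other two start the induction at
   [N] and [N.+1]. *)
pose M := A `^ s + u N * N%:R `^ s + u N.+1 * N.+1%:R `^ s.
have As0 : 0 < A `^ s by rewrite powR_gt0.
have [h1 h2] : 0 <= u N * N%:R `^ s /\ 0 <= u N.+1 * N.+1%:R `^ s.
  by split; rewrite mulr_ge0 ?powR_ge0 // ltW.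
have M0 : 0 < M by rewrite /M; lra.
have MA : A <= M `^ (p - 1).
  have AE : A = (A `^ s) `^ (p - 1) by rewrite -powRrM sp powRr1 // ltW.
  rewrite [leLHS]AE ge0_ler_powR ?nnegrE ?(ltW As0) ?(ltW M0) //.
    by lra.
  by rewrite /M; lra.
exists M => //.
have nat0 k : (N <= k)%N -> 0 < k%:R :> R by move=> Nk; rewrite ltr0n (leq_trans N1).
suff P j : u (N + j)%N <= M * (N + j)%:R `^ (- s) /\
           u (N + j).+1 <= M * (N + j).+1%:R `^ (- s).
  by move=> k Nk; rewrite -(subnKC Nk); case: (P (k - N)%N).
elim: j => [|j [IH1 IH2]].
  by rewrite addn0 !powRN -!ler_pdivrMr ?invr_gt0 ?powR_gt0 ?nat0 // !invrK /M; split; lra.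
rewrite addnS; split => //; set k := (N + j)%N in IH1 IH2 *.
have Nk : (N <= k)%N by rewrite leq_addr.
have k0 := nat0 k Nk; have k1 : 1 <= k%:R :> R by rewrite ler1n (leq_trans N1).
have k20 : 0 < k.+2%:R :> R by [].
rewrite leNgt; apply/negP; set v := M * _ => vu.
have v0 : 0 < v by rewrite mulr_gt0 ?powR_gt0.
have vp : v `^ p <= u k.+2 `^ p by rewrite ge0_ler_powR ?nnegrE ?(ltW v0) ?(ltW vu) ?ltW //; lra.
have vE : v `^ p = v * (M `^ (p - 1) / k.+2%:R).
  rewrite -(mulr_powRB1 (ltW v0)) /v; last by lra.
  by rewrite [(M * _) `^ (p - 1)]powRM ?powR_ge0 ?ltW // -powRrM mulNr sp powR_inv1.
have E : u k <= v * (k.+2%:R / k%:R) `^ s.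
  rewrite (le_trans IH1) // /v -mulrA ler_pM2l // !powRN powRM ?invr_ge0 ?(ltW k0) ?(ltW k20) //.
  rewrite mulrA mulVf ?mul1r ?gt_eqF ?powR_gt0 //.
  by rewrite -[k%:R^-1]powR_inv1 ?(ltW k0) // -powRrM mulN1r powRN.
have F : (k.+2%:R / k%:R) `^ s <= 1 + A / K / k.+2%:R :> R.
  have -> : k.+2%:R / k%:R = 1 + 2 / k%:R :> R.
    by rewrite -[k.+2]addn2 natrD; field; lra.
  have y0 : 0 <= 2 / k%:R :> R by rewrite divr_ge0 // ltW.
  have y2 : 2 / k%:R <= 2 :> R by rewrite ler_pdivrMr // ler_peMr.
  rewrite (le_trans (powR_onePx_le (ltW s0) y0)) // lerD2l.
  have -> : A / K / k.+2%:R = s * (6 / k.+2%:R) * expR (2 * s).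
    by rewrite /A; move: (k.+2%:R) k20 => z z0; field; rewrite !gt_eqF.
  apply: ler_pM; rewrite ?mulr_ge0 ?expR_ge0 ?(ltW s0) //.
    rewrite ler_pM2l // ler_pdivrMr // mulrAC ler_pdivlMr //.
    by rewrite -[k.+2]addn2 natrD; lra.
  by rewrite ler_expR mulrC ler_pM2r.
have AM : A / K / k.+2%:R <= M `^ (p - 1) / K / k.+2%:R.
  by rewrite ler_pM2r ?invr_gt0 // ler_pM2r ?invr_gt0.
have := H k Nk; rewrite mulrC -ler_pdivrMr // => Hk.
have : v * (M `^ (p - 1) / K / k.+2%:R) <= u k - u k.+2.
  rewrite (le_trans _ Hk) // ler_pdivlMr // (le_trans _ vp) // vE.
  move: (k.+2%:R) k20 => z z0.
  by rewrite [leLHS](_ : _ = v * (M `^ (p - 1) / z)) //; field; rewrite !gt_eqF.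
move=> h3; have : u k <= v + (u k - u k.+2).
  by rewrite (le_trans E) // (le_trans (ler_wpM2l (ltW v0) F)) //
    mulrDr mulr1 lerD2l (le_trans _ h3) // ler_pM2l.
by rewrite addrCA lerDl subr_ge0 leNgt vu.
Qed.

End Sequences.

(** * Descent sequences under the Kurdyka-Lojasiewicz inequality *)

Lemma nonincreasing_seq_le {R : realType} (u : nat -> R) :
  (forall k, u k.+1 <= u k) -> forall j k, (j <= k)%N -> u k <= u j.
Proof.
move=> H j k /subnKC <-; elim: (k - j)%N => [|i IH]; first by rewrite addn0.
by rewrite addnS (le_trans (H _)).
Qed.

Section Descent.
Context {R : realType} {n : nat}.
Variables (x : nat -> 'rV[R]_n) (r : nat -> R) (xs : 'rV[R]_n) (a C : R).
Let d k := enorm (x k.+1 - x k).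
Hypotheses (a0 : 0 < a) (C0 : 0 < C).
Hypothesis descent : forall k, a * d k ^+ 2 <= r k - r k.+1.
Hypothesis r_ge0 : forall k, 0 <= r k.
Hypothesis r_small : forall e : R, 0 < e -> exists k, r k < e.
Hypothesis x_cluster :
  forall (e : R) N, 0 < e -> exists2 k, (N <= k)%N & enorm (x k - xs) < e.

Let d_ge0 k : 0 <= d k. Proof. exact: enorm_ge0. Qed.

Let r_decr : forall j k, (j <= k)%N -> r k <= r j.
Proof.
apply: nonincreasing_seq_le => k; rewrite -subr_ge0 (le_trans _ (descent k)) //.
by rewrite mulr_ge0 ?sqr_ge0 ?ltW.
Qed.

Let r_lim (e : R) : 0 < e -> exists N, forall k, (N <= k)%N -> r k < e.
Proof.
move=> /r_small[N rN]; exists N => k Nk; exact: le_lt_trans (r_decr Nk) rN.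
Qed.

Let d_le k : d k <= Num.sqrt (r k / a).
Proof.
rewrite -[leLHS]ger0_norm // -sqrtr_sqr ler_wsqrtr // ler_pdivlMr // mulrC.
have := descent k; have := r_ge0 k.+1; lra.
Qed.

Let d_lim (e : R) : 0 < e -> exists N, forall k, (N <= k)%N -> d k < e.
Proof.
move=> e0; have [|N NP] := @r_lim (a * e ^+ 2); first by rewrite mulr_gt0 ?exprn_gt0.
exists N => k /NP rk; rewrite -ltr_sqr ?nnegrE ?(ltW e0) // -(ltr_pM2l a0).
have := descent k; have := r_ge0 k.+1; lra.
Qed.

(** The values stay at 0 after [N], so descent makes every later step vanish; the constant tail must
    equal its cluster point. *)
Lemma descent_stationary N : r N = 0 -> forall k, (N <= k)%N -> x k = xs.
Proof.
move=> rN.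
have r0 k : (N <= k)%N -> r k = 0.
  by move=> Nk; apply/eqP; rewrite eq_le r_ge0 -rN r_decr.
have xE k : (N <= k)%N -> x k = x N.
  move=> /subnKC <-; elim: (k - N)%N => [|j IH]; first by rewrite addn0.
  rewrite addnS -IH; apply/eqP; rewrite -subr_eq0; apply/eqP/enorm_eq0/eqP.
  rewrite -sqrf_eq0 -(mulrI_eq0 _ (lregP (lt0r_neq0 a0))) eq_le.
  by rewrite (le_trans (descent _)) ?r0 ?subrr ?leqW ?leq_addr //= mulr_ge0 ?sqr_ge0 ?ltW.
move=> k /xE ->; apply/eqP; rewrite -subr_eq0; apply/eqP/enorm_eq0/eqP.
rewrite eq_le enorm_ge0 andbT; apply/ler_addgt0Pr => e e0.
by have [j /xE -> /ltW] := x_cluster N e0; rewrite add0r.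
Qed.

(** * Convergence of descent sequences through a desingularizing function *)

Section Desingularized.
Variables (phi dphi : R -> R) (nu rho : R).
Hypotheses (nu0 : 0 < nu) (rho0 : 0 < rho).
Hypothesis phi_ge0 : forall s, 0 <= s < nu -> 0 <= phi s.
Hypothesis phi_lim : forall e : R, 0 < e ->
  exists2 b : R, 0 < b & forall s, 0 <= s < nu -> s < b -> phi s < e.
Hypothesis dphi_gt0 : forall s, 0 < s < nu -> 0 < dphi s.
Hypothesis phi_concave : forall s b, 0 < s < nu -> 0 <= b <= s ->
  dphi s * (s - b) <= phi s - phi b.
Hypothesis r_gt0 : forall k, 0 < r k.
Hypothesis KL_ineq : forall k, enorm (x k.+1 - xs) < rho -> r k.+1 < nu ->
  1 <= dphi (r k.+1) * (C * (d k + d k.+1)).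

Let M := 4 * C / a.
Let M0 : 0 < M. Proof. by rewrite divr_gt0 ?mulr_gt0. Qed.

(* By the Kurdyka-Lojasiewicz inequality the decrease of [phi \o r] dominates
   [d k.+1 ^+ 2 / (d k + d k.+1)]; AM-GM then makes the estimate telescope. *)
Let step k : enorm (x k.+1 - xs) < rho -> r k.+1 < nu ->
  3 * d k.+1 + M * phi (r k.+2) <= d k + M * phi (r k.+1).
Proof.
move=> xk rk; have rr : 0 < r k.+1 < nu by rewrite r_gt0.
have g0 := dphi_gt0 rr; have KL := KL_ineq xk rk.
have := phi_concave rr (b := r k.+2); rewrite r_ge0 r_decr // => /(_ isT) cc.
set p := phi (r k.+1) in cc *; set q := phi (r k.+2) in cc *.
set g := dphi _ in g0 KL cc; set u := d k in KL *; set v := d k.+1 in KL *.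
have u0 : 0 <= u := d_ge0 k; have v0 : 0 <= v := d_ge0 k.+1.
have h1 : g * (a * v ^+ 2) <= p - q.
  apply: le_trans cc; rewrite ler_pM2l //; exact: descent.
have h2 : a * v ^+ 2 <= C * (u + v) * (p - q).
  apply: (@le_trans _ _ (C * (u + v) * (g * (a * v ^+ 2)))); last first.
    by rewrite ler_wpM2l // mulr_ge0 ?addr_ge0 // ltW.
  rewrite [leRHS]mulrA -[leLHS]mul1r ler_wpM2r //.
    by rewrite mulr_ge0 ?sqr_ge0 // ltW.
  by rewrite mulrC.
pose E := M * (p - q).
have pq : 0 <= p - q by rewrite (le_trans _ h1) // !mulr_ge0 ?sqr_ge0 // ltW.
have E0 : 0 <= E by rewrite mulr_ge0 // ltW.
have h3 : 4 * v ^+ 2 <= E * (u + v).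
  rewrite -(ler_pM2l a0) /E /M mulrCA.
  rewrite [leRHS](_ : _ = 4 * (C * (u + v) * (p - q))); first by rewrite ler_pM2l.
  by field; rewrite gt_eqF.
have : 4 * v <= E + u + v.
  rewrite -ler_sqr ?nnegrE ?(mulr_ge0 _ v0) ?(addr_ge0 (addr_ge0 E0 u0) v0) //.
  rewrite (_ : (4 * v) ^+ 2 = 4 * (4 * v ^+ 2)); last by ring.
  rewrite (_ : (E + u + v) ^+ 2 = (E - (u + v)) ^+ 2 + 4 * (E * (u + v))); last by ring.
  by rewrite ler_wpDl ?sqr_ge0 // ler_pM2l.
have -> : E = M * p - M * q by rewrite /E mulrBr.
lra.
Qed.

(** While the iterates stay within [rho], [step] telescopes: of its [3 * d k.+1], two parts pay for
    the distance travelled and one is carried on. The resulting bound keeps the next iterate within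
    [e]. *)
Let trap m (e : R) : e <= rho -> r m.+1 < nu ->
    enorm (x m.+1 - xs) + (d m + M * phi (r m.+1)) < e -> forall j,
  [/\ enorm (x (m.+1 + j)%N - xs) < e &
      2 * enorm (x (m.+1 + j)%N - x m.+1) + d (m + j) + M * phi (r (m.+1 + j)%N)
        <= d m + M * phi (r m.+1)].
Proof.
move=> erho rm me.
have phir k : (m.+1 <= k)%N -> 0 <= M * phi (r k).
  by move=> mk; rewrite mulr_ge0 ?(ltW M0) // phi_ge0 // r_ge0 (le_lt_trans (r_decr mk)).
elim=> [|j [IH1 IH2]].
  rewrite !addn0 subrr enorm0 mulr0 add0r; split => //.
  by apply: le_lt_trans me; rewrite lerDl addr_ge0 ?phir.
have rj : r (m.+1 + j)%N < nu by rewrite (le_lt_trans (r_decr (leq_addr _ _))).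
have := @step (m + j)%N; rewrite -addSn => /(_ (lt_le_trans IH1 erho) rj) st.
have tri := ler_enorm_dist (x (m.+1 + j.+1)%N) (x (m.+1 + j)%N) (x m.+1).
rewrite -[enorm (_ - x (m.+1 + j)%N)]/(enorm _) addnS in tri *.
have dE : enorm (x (m.+1 + j).+1 - x (m.+1 + j)%N) = d (m.+1 + j) by [].
rewrite dE in tri; rewrite addnS -addSn.
have key : 2 * enorm (x (m.+1 + j).+1 - x m.+1) + d (m.+1 + j) +
    M * phi (r (m.+1 + j).+1) <= d m + M * phi (r m.+1) by lra.
split=> //.
have := ler_enorm_dist (x (m.+1 + j).+1) (x m.+1) xs.
have := phir (m.+1 + j).+1 (leqW (leq_addr _ _)).
have := d_ge0 (m.+1 + j); have := enorm_ge0 (x (m.+1 + j).+1 - x m.+1).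
move: me key; lra.
Qed.

Let small_tail (e : R) : 0 < e -> exists N, forall k, (N <= k)%N ->
  [/\ r k.+1 < nu, r k < nu & d k + M * phi (r k.+1) < e].
Proof.
move=> e0; have e2 : 0 < e / 2 by rewrite divr_gt0.
have [b b0 bP] := phi_lim (divr_gt0 e2 M0).
have [N1 N1P] := d_lim e2; have [|N2 N2P] := @r_lim (Num.min nu b).
  by rewrite lt_min nu0.
exists (maxn N1 N2) => k; rewrite geq_max => /andP[k1 k2].
have := N2P k k2; have := N2P _ (leqW k2); rewrite !lt_min => /andP[r1 rb] /andP[r2 _].
split => //; have := N1P k k1; have := bP (r k.+1); rewrite r_ge0 r1 => /(_ isT rb).
rewrite ltr_pdivlMr // mulrC; lra.
Qed.

Let descent_cvg_eps (e : R) : 0 < e -> exists N, forall k, (N <= k)%N ->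
  enorm (x k - xs) < e.
Proof.
move=> e0; pose e' := Num.min e rho.
(* Asking for an index above [N] makes it a successor [m.+1] with [N <= m], the form that [trap]
   takes. *)
have e'0 : 0 < e' / 2 by rewrite divr_gt0 // lt_min e0.
have [N NP] := small_tail e'0; have [[|m] Nm xm] := x_cluster N.+1 e'0; first by [].
have [rm _ dm] := NP m Nm.
exists m.+1 => k /subnKC <-.
have [||+ _] := @trap m e' _ rm _ (k - m.+1)%N; rewrite ?ge_min ?lexx ?orbT //; first lra.
by move=> h; rewrite (lt_le_trans h) // ge_min lexx.
Qed.

Lemma descent_cvg : x @ \oo --> xs.
Proof. exact/cvg_enormP/descent_cvg_eps. Qed.

(** [trap] bounds the distance from [x k.+1] to all later iterates; the limit replaces these by
    [xs], and one more [d k] leads back to [x k]. *)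
Lemma descent_dist_le : exists N, forall k, (N <= k)%N ->
  [/\ r k < nu, enorm (x k - xs) < rho &
    enorm (x k - xs) <= 2 * d k + M * phi (r k.+1)].
Proof.
have r2 : 0 < rho / 2 by rewrite divr_gt0.
have [N1 N1P] := small_tail r2; have [N2 N2P] := descent_cvg_eps r2.
exists (maxn N1 N2) => k; rewrite geq_max => /andP[k1 k2].
have [rk1 rk dk] := N1P k k1; have xk := N2P k k2.
have xk1 := N2P _ (leqW k2); split => //; first lra.
have tr j := @trap k rho (lexx _) rk1 (ltac:(lra)) j.
suff : enorm (x k.+1 - xs) <= d k + M * phi (r k.+1).
  have := ler_enorm_dist (x k) (x k.+1) xs; rewrite (enorm_distC (x k) (x k.+1)) -/(d k); lra.
apply/ler_addgt0Pr => e /descent_cvg_eps[N NP].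
have := NP (k.+1 + N)%N (leq_addl _ _); have [_] := tr N.
have := ler_enorm_dist (x k.+1) (x (k.+1 + N)%N) xs.
have := d_ge0 (k + N); have := enorm_ge0 (x (k.+1 + N)%N - x k.+1).
rewrite (enorm_distC (x k.+1) (x (k.+1 + N)%N)).
have : 0 <= M * phi (r (k.+1 + N)%N).
  by rewrite mulr_ge0 ?(ltW M0) // phi_ge0 // r_ge0 (le_lt_trans (r_decr (leq_addr _ _))).
lra.
Qed.

End Desingularized.

(** * Convergence rates for a power desingularizing function *)

Section Rates.
Variables (c theta nu rho : R).
Hypotheses (c0 : 0 < c) (t0 : 0 <= theta) (t1 : theta < 1).
Hypotheses (nu0 : 0 < nu) (rho0 : 0 < rho).
Hypothesis r_gt0 : forall k, 0 < r k.
Hypothesis KL_ineq : forall k, enorm (x k.+1 - xs) < rho -> r k.+1 < nu ->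
  1 <= c * (1 - theta) * r k.+1 `^ (- theta) * (C * (d k + d k.+1)).
Hypothesis dist_le : exists B N, forall k, (N <= k)%N ->
  [/\ r k < nu, enorm (x k - xs) < rho &
    enorm (x k - xs) <= 2 * d k + B * (c * r k.+1 `^ (1 - theta))].

Let C1 := c * (1 - theta) * C.
Let K := 2 * C1 ^+ 2 / a.

Let K0 : 0 < K.
Proof. by rewrite divr_gt0 // mulr_gt0 // exprn_gt0 // !mulr_gt0 // subr_gt0. Qed.

(** The Kurdyka-Lojasiewicz inequality bounds the power [theta] of [r k.+1] by
    [C1 * (d k + d k.+1)]; it is squared and two descent steps are added. Monotonicity lowers
    [r k.+1] to [r k.+2], so that only [r k] and [r k.+2] remain. *)
Let value_decrease : exists N, forall k, (N <= k)%N ->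
  r k.+2 `^ (2 * theta) <= K * (r k - r k.+2).
Proof.
have [B [N NP]] := dist_le; exists N => k Nk.
have [r1 x1 _] := NP _ (leqW Nk); have := KL_ineq x1 r1.
pose y := r k.+1 `^ theta; rewrite powRN -/y => h.
have y0 : 0 < y by rewrite powR_gt0.
have h1 : y <= C1 * (d k + d k.+1).
  have := ler_wpM2l (ltW y0) h; rewrite mulr1 => /le_trans; apply.
  rewrite [leLHS](_ : _ = C1 * (d k + d k.+1)) // /C1; field.
  by rewrite gt_eqF.
have C10 : 0 < C1 by rewrite !mulr_gt0 // subr_gt0.
have h2 : y ^+ 2 <= C1 ^+ 2 * (d k + d k.+1) ^+ 2.
  by rewrite -exprMn ler_sqr ?nnegrE ?(ltW y0) // mulr_ge0 ?addr_ge0 ?(ltW C10).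
have h3 : (d k + d k.+1) ^+ 2 <= 2 * (d k ^+ 2 + d k.+1 ^+ 2).
  by have := sqr_ge0 (d k - d k.+1); lra.
have h4 : a * (d k ^+ 2 + d k.+1 ^+ 2) <= r k - r k.+2.
  by have := descent k; have := descent k.+1; lra.
have h5 : r k.+2 `^ (2 * theta) <= y ^+ 2.
  rewrite mulrC -powR_mulrn ?powR_ge0 // /y -powRrM.
  by rewrite ge0_ler_powR ?nnegrE ?r_ge0 ?r_decr // mulr_ge0.
rewrite (le_trans h5) // (le_trans h2) //.
rewrite (le_trans (ler_wpM2l (sqr_ge0 _) h3)) //.
have := ler_wpM2l (ltW K0) h4; apply: le_trans.
rewrite le_eqVlt; apply/orP; left; apply/eqP; rewrite /K; field.
by rewrite gt_eqF.
Qed.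

(** With exponent 0 the left side of [value_decrease] is 1 while the right side tends to 0. Positive
    values thus exclude [theta = 0], and finite termination is the case where some [r N]
    vanishes. *)
Lemma rate_exponent0 : theta <> 0.
Proof.
move=> th; have [N NP] := value_decrease; have [|N2 N2P] := @r_lim K^-1.
  by rewrite invr_gt0.
have := NP (maxn N N2) (leq_maxl _ _); rewrite th mulr0 powRr0.
have := N2P _ (leq_maxr N N2); rewrite -(ltr_pM2l K0) mulfV ?gt_eqF // => h.
by have := mulr_gt0 K0 (r_gt0 (maxn N N2).+2); lra.
Qed.

(** The two terms of [dist_le] are bounded by multiples of the powers [2^-1] (by descent) and
    [1 - theta] of [r k]; once [r k < 1], lowering the exponent only weakens the bound. *)
Let dist_le_powR (e : R) : 0 <= e -> e <= 2^-1 -> e <= 1 - theta ->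
  exists2 B, 0 <= B & exists N, forall k, (N <= k)%N ->
    enorm (x k - xs) <= B * r k `^ e.
Proof.
move=> e0 e2 et; have [B [N NP]] := dist_le; have [N1 N1P] := r_lim ltr01.
exists (2 * Num.sqrt a^-1 + `|B| * c).
  by rewrite addr_ge0 ?mulr_ge0 ?sqrtr_ge0 ?(ltW c0).
exists (maxn N N1) => k; rewrite geq_max => /andP[/NP[_ _ xk] /N1P rk].
rewrite (le_trans xk) // [leRHS]mulrDl lerD //.
  have dE : Num.sqrt (r k / a) = Num.sqrt a^-1 * r k `^ 2^-1.
    by rewrite mulrC sqrtrM ?invr_ge0 ?(ltW a0) // powR12_sqrt.
  rewrite -mulrA ler_pM2l // (le_trans (d_le k)) // dE ler_wpM2l ?sqrtr_ge0 //.
  by rewrite ger_powR // r_gt0 ltW.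
apply: (@le_trans _ _ (`|B| * (c * r k.+1 `^ (1 - theta)))).
  by rewrite ler_wpM2r ?ler_norm // mulr_ge0 ?powR_ge0 // ltW.
rewrite -mulrA ler_wpM2l // ler_pM2l //.
apply: (@le_trans _ _ (r k `^ (1 - theta))).
  by rewrite ge0_ler_powR ?nnegrE ?r_ge0 ?r_decr // subr_ge0 ltW.
by rewrite ger_powR // r_gt0 ltW.
Qed.

(** As [2 * theta <= 1], a value below 1 is at most its power [2 * theta], so [value_decrease]
    becomes a contraction by [K / (1 + K)] over two steps. Distances follow with exponent [2^-1],
    hence the rate [Num.sqrt q]. *)
Lemma rate_linear : theta <= 2^-1 -> exists mu q, [/\ 0 < mu, 0 < q < 1 &
  forall k, (1 <= k)%N -> enorm (x k - xs) <= mu * q ^+ k].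
Proof.
move=> th; have [N NP] := value_decrease; have [N1 N1P] := r_lim ltr01.
have K1 : 0 < 1 + K by rewrite addr_gt0.
have l01 : 0 < K / (1 + K) < 1.
  by rewrite divr_gt0 //= ltr_pdivrMr // mul1r ltrDr.
have [k Nk|M [q [M0 /andP[q0 q1] rq]]] := @two_step_linear_decay _ r _ (maxn N N1) r_ge0 l01.
  move: Nk; rewrite geq_max => /andP[/NP h /leqW/leqW/N1P rk].
  rewrite mulrAC ler_pdivlMr //.
  have : r k.+2 <= r k.+2 `^ (2 * theta).
    by rewrite ger1_powR ?r_gt0 ?(ltW rk) //; lra.
  lra.
have [|||B B0 [N2 N2P]] := @dist_le_powR 2^-1; rewrite ?invr_ge0 //; first lra.
have sq0 : 0 < Num.sqrt q by rewrite sqrtr_gt0.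
have [|k Nk|mu mu0 muP] := @eventually_le_scale _ (fun k => enorm (x k - xs))
    (fun k => Num.sqrt q ^+ k) (maxn N2 (maxn N N1)) (B * Num.sqrt M).
- by move=> k _; rewrite exprn_gt0.
- move: Nk; rewrite geq_max => /andP[/N2P h /rq rk].
  rewrite (le_trans h) // -mulrA ler_wpM2l // powR12_sqrt ?r_ge0 //.
  have -> : Num.sqrt q ^+ k = Num.sqrt (q ^+ k).
    elim: (k) => [|i IH]; first by rewrite !expr0 sqrtr1.
    by rewrite !exprS sqrtrM ?IH // ltW.
  by rewrite -sqrtrM // ler_wsqrtr.
exists mu, (Num.sqrt q); split => //.
by rewrite sq0 /= -sqrtr1 ltr_sqrt.
Qed.

(** The values decay with exponent [- (2 * theta - 1)^-1]; the distance exponent [1 - theta], here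
    below [2^-1], multiplies it. *)
Lemma rate_sublinear : 2^-1 < theta -> exists2 mu, 0 < mu &
  forall k, (1 <= k)%N ->
    enorm (x k - xs) <= mu * k%:R `^ ((1 - theta) / (1 - 2 * theta)).
Proof.
move=> th; have [N NP] := value_decrease.
have p1 : 1 < 2 * theta by lra.
have [|k|M M0 rM] := @two_step_sublinear_decay _ r K (2 * theta) N.+1 r_gt0 K0 p1.
- by [].
- by move=> /ltnW/NP.
have [|||B B0 [N2 N2P]] := @dist_le_powR (1 - theta).
- by rewrite subr_ge0 ltW.
- lra.
- by [].
apply: (@eventually_le_scale _ (fun k => enorm (x k - xs)) _ (maxn N2 N.+1)
  (B * M `^ (1 - theta))) => k.
  by move=> k1; rewrite powR_gt0 // ltr0n.
rewrite geq_max => /andP[/N2P h /rM rk]; rewrite (le_trans h) // -mulrA ler_wpM2l //.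
have -> : (1 - theta) / (1 - 2 * theta) = - (2 * theta - 1)^-1 * (1 - theta).
  by rewrite mulrC -invrN opprB.
rewrite powRrM -powRM ?powR_ge0 ?(ltW M0) //.
by rewrite ge0_ler_powR ?nnegrE ?r_ge0 ?mulr_ge0 ?powR_ge0 ?subr_ge0 ?(ltW M0) ?(ltW t1).
Qed.

End Rates.

End Descent.

(** * The Kurdyka-Lojasiewicz property along a descent sequence *)

(** By concavity the slope of [phi] over [[s - u, s]] is at most that over [[b, s]] for small
    [u > 0], and the derivative is the limit of the former. *)
Lemma concave_tangent {R : realType} (phi : R -> R) (nu s b : R) :
  convex_function `[0, nu[ (\- phi : R -> R^o) -> derivable phi s 1 ->
  0 < s < nu -> 0 <= b <= s ->
  derive1 phi s * (s - b) <= phi s - phi b.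
Proof.
move=> cphi ds /andP[s0 snu] /andP[b0]; rewrite le_eqVlt => /predU1P[->|bs].
  by rewrite !subrr mulr0.
have sb : 0 < s - b by rewrite subr_gt0.
set m := derive1 phi s; rewrite leNgt; apply/negP => Hm.
pose e := m - (phi s - phi b) / (s - b).
have e0 : 0 < e by rewrite subr_gt0 ltr_pdivrMr.
have [dl dl0 dlP] : exists2 dl, 0 < dl & forall u, `|u| < dl -> u != 0 ->
    `|m - u^-1 * (phi (u + s) - phi s)| < e.
  have : h^-1 *: (phi (h *: 1 + s) - phi s) @[h --> 0^'] --> m.
    by rewrite /m derive1E; exact: ds.
  move=> /cvgrPdist_lt /(_ e e0) /nbhs_ballP[dl /= dl0 dlP]; exists dl => // u ud u0.
  by have := dlP u; rewrite /ball /= sub0r normrN => /(_ ud u0); rewrite [u *: 1]mulr1.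
pose u := Num.min (dl / 2) (s - b).
have u0 : 0 < u by rewrite lt_min sb divr_gt0.
have udl : u < dl.
  by rewrite (@le_lt_trans _ _ (dl / 2)) ?ge_min ?lexx //
    ltr_pdivrMr // ltr_pMr // ltr1n.
have usb : u <= s - b by rewrite ge_min lexx orbT.
have := dlP (- u); rewrite normrN gtr0_norm // oppr_eq0 gt_eqF // => /(_ udl isT).
rewrite ltr_norml => /andP[_]; rewrite invrN mulNr opprK.
pose l := u / (s - b).
have l01 : 0 <= l <= 1 by rewrite divr_ge0 ?(ltW u0) ?(ltW sb) //= ler_pdivrMr // mul1r.
have bI : b \in [set` `[0, nu[] by rewrite inE /= in_itv /= b0 (lt_trans bs snu).
have sI : s \in [set` `[0, nu[] by rewrite inE /= in_itv /= (ltW s0) snu.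
have [l0 l1] := andP l01.
have h1 : - phi (l * b + (1 - l) * s) <= l * - phi b + (1 - l) * - phi s.
  exact: cphi (Itv01 l0 l1) b s bI sI.
have E : l * b + (1 - l) * s = - u + s by rewrite /l; field; rewrite gt_eqF.
rewrite E in h1 => h2.
have : u * e <= u * m + (phi (- u + s) - phi s).
  have {}E : (phi s - phi b) / (s - b) * u = l * (phi s - phi b).
    by rewrite /l; ring.
  rewrite /e mulrBr [u * (_ / _)]mulrC E; lra.
have : u * (m + u^-1 * (phi (- u + s) - phi s)) < u * e by rewrite ltr_pM2l.
rewrite mulrDr mulrA mulfV ?gt_eqF // mul1r; lra.
Qed.

Section KLConvergence.
Context {R : realType} {n : nat}.
Variables (f : 'rV[R]_n -> \bar R) (sub : 'rV[R]_n -> set 'rV[R]_n).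
Variables (x : nat -> 'rV[R]_n) (xs : 'rV[R]_n) (a C : R).
Let d k := enorm (x k.+1 - x k).
Let r k := fine (f (x k)) - fine (f xs).
Hypotheses (a0 : 0 < a) (C0 : 0 < C).
Hypothesis fx_fin : forall k, f (x k) \is a fin_num.
Hypothesis fxs_fin : f xs \is a fin_num.
Hypothesis descent : forall k,
  a * d k ^+ 2 <= fine (f (x k)) - fine (f (x k.+1)).
Hypothesis f_ge : forall k, (f xs <= f (x k))%E.
Hypothesis f_small : forall e : R, 0 < e ->
  exists k, fine (f (x k)) < fine (f xs) + e.
Hypothesis x_cluster :
  forall (e : R) N, 0 < e -> exists2 k, (N <= k)%N & enorm (x k - xs) < e.
Hypothesis sub_le : forall k,
  (dist0 (sub (x k.+1)) <= (C * (d k + d k.+1))%:E)%E.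

Let r_descent k : a * d k ^+ 2 <= r k - r k.+1.
Proof. by rewrite /r opprB addrA subrK. Qed.

Let r_ge0 k : 0 <= r k.
Proof. by rewrite subr_ge0 fine_le. Qed.

Let r_small (e : R) : 0 < e -> exists k, r k < e.
Proof. by move=> /f_small[k fk]; exists k; rewrite ltrBlDl. Qed.

(** Supplies the real-variable hypotheses of the descent estimates: continuity at 0 makes [phi]
    small, concavity gives the tangent inequality, and [sub_le] turns the distance to the
    subdifferential into step lengths. *)
Lemma KL_with_sequence phi : KL_with sub f xs phi -> (forall k, 0 < r k) ->
  exists nu rho, [/\ 0 < nu, 0 < rho,
    [/\ (forall s, 0 <= s < nu -> 0 <= phi s),
      (forall e : R, 0 < e ->
        exists2 b : R, 0 < b & forall s, 0 <= s < nu -> s < b -> phi s < e),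
      (forall s, 0 < s < nu -> 0 < derive1 phi s) &
      (forall s b, 0 < s < nu -> 0 <= b <= s ->
        derive1 phi s * (s - b) <= phi s - phi b)] &
    (forall k, enorm (x k.+1 - xs) < rho -> r k.+1 < nu ->
      1 <= derive1 phi (r k.+1) * (C * (d k + d k.+1)))].
Proof.
move=> [nu [V [nu0 /nbhs_enormP[rho rho0 rV] [cphi cvx phi0 phi00] dphi KLV]]] rgt0.
exists nu, rho; split => //; first split.
- by move=> s snu; apply: phi0; rewrite in_itv.
- move=> e e0.
  have I0 : [set` `[0, nu[] (0 : R) by rewrite /= in_itv /= lexx.
  move/subspace_continuousP : cphi => /(_ 0 I0)/cvgrPdist_lt/(_ e e0).
  rewrite /from_subspace phi00 near_withinE => /nbhs_ballP[b /= b0 bP]; exists b => // s snu sb.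
  have s0 : 0 <= s by case/andP: snu.
  have := bP s; rewrite /ball /= !sub0r !normrN ger0_norm // => /(_ sb).
  rewrite in_itv /= => /(_ snu); exact: le_lt_trans (ler_norm _).
- by move=> s snu; have [] := dphi s; rewrite ?in_itv.
- by move=> s b snu; apply: concave_tangent => //; have [] := dphi s; rewrite ?in_itv.
move=> k /rV Vx rnu.
have fr : f (x k.+1) = (fine (f xs) + r k.+1)%:E.
  by rewrite /r addrC subrK fineK.
have := KLV _ Vx; rewrite -[f xs]fineK // fr -EFinD !lte_fin ltrDl rgt0 ltrD2l rnu.
rewrite -EFinB /= addrAC subrr add0r => /(_ isT) H.
have [_ _ g0] : [/\ derivable phi (r k.+1) 1, {for r k.+1, continuous (derive1 phi)} &
    0 < derive1 phi (r k.+1)] by apply: dphi; rewrite in_itv /= rgt0.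
rewrite -lee_fin (le_trans H) // EFinM lee_pmul2l //.
Qed.

Lemma KL_descent_convergence : KL sub f xs -> x @ \oo --> xs.
Proof.
(* The inequality is only available at values above [f xs]; a sequence that reaches this value is
   stationary. *)
move=> [phi KLp]; have [[N rN]|/forallNP rn0] := pselect (exists N, r N = 0).
  have st := descent_stationary a0 r_descent r_ge0 x_cluster rN.
  by apply/cvg_enormP => e e0; exists N => k /st ->; rewrite subrr enorm0.
have rgt0 k : 0 < r k by rewrite lt_neqAle r_ge0 andbT eq_sym; exact/eqP/rn0.
have [nu [rho [nu0 rho0 [p1 p2 p3 p4] KLi]]] := KL_with_sequence KLp rgt0.
exact: (descent_cvg a0 C0 r_descent r_ge0 r_small x_cluster nu0 rho0 p1 p2 p3 p4 rgt0 KLi).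
Qed.

Lemma KL_descent_rates (c theta : R) : 0 < c -> 0 <= theta < 1 ->
  KL_with sub f xs (fun s => c * s `^ (1 - theta)) ->
  [/\ theta = 0 -> exists N, forall k, (N <= k)%N -> x k = xs,
      0 < theta <= 2^-1 ->
        exists mu q : R, [/\ 0 < mu, 0 < q < 1 &
          forall k, (1 <= k)%N -> enorm (x k - xs) <= mu * q ^+ k] &
      2^-1 < theta < 1 ->
        exists2 mu : R, 0 < mu &
          forall k, (1 <= k)%N ->
            enorm (x k - xs) <=
            mu * k%:R `^ ((1 - theta) / (1 - 2 * theta))].
Proof.
move=> c0 /andP[t0 t1] KLp; have [[N rN]|/forallNP rn0] := pselect (exists N, r N = 0).
  have st := descent_stationary a0 r_descent r_ge0 x_cluster rN.
  have st0 w k : (N <= k)%N -> enorm (x k - xs) <= 0 * w k.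
    by move=> /st ->; rewrite subrr enorm0 mul0r.
  split=> [_|_|_]; first by exists N.
    have [|mu mu0 muP] := eventually_le_scale _ (st0 (fun k => 2^-1 ^+ k)).
      by move=> k _; rewrite exprn_gt0 // invr_gt0.
    exists mu, 2^-1; split => //; apply/andP; split; lra.
  apply: (eventually_le_scale _ (st0 _)) => k k1.
  by rewrite powR_gt0 // ltr0n.
have rgt0 k : 0 < r k by rewrite lt_neqAle r_ge0 andbT eq_sym; exact/eqP/rn0.
have [nu [rho [nu0 rho0 [p1 p2 p3 p4] KLi]]] := KL_with_sequence KLp rgt0.
have [N NP] := descent_dist_le a0 C0 r_descent r_ge0 r_small x_cluster nu0 rho0
  p1 p2 p3 p4 rgt0 KLi.
have KLr k : enorm (x k.+1 - xs) < rho -> r k.+1 < nu ->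
    1 <= c * (1 - theta) * r k.+1 `^ (- theta) * (C * (d k + d k.+1)).
  move=> xk rk; have := KLi k xk rk.
  rewrite derive1E (@derive_val _ _ _ _ _ _ _
    (is_deriveZ c (is_derive1_powR (1 - theta) (rgt0 k.+1)))).
  by rewrite addrAC subrr add0r -[_ *: _]/(c * _) mulrA.
have dl : exists B N, forall k, (N <= k)%N -> [/\ r k < nu, enorm (x k - xs) < rho &
    enorm (x k - xs) <= 2 * d k + B * (c * r k.+1 `^ (1 - theta))].
  by exists (4 * C / a), N.
split=> [th|/andP[_ th]|/andP[th _]].
- by have := rate_exponent0 a0 C0 r_descent r_ge0 r_small c0 t0 t1 rgt0 KLr dl th.
- exact: (rate_linear a0 C0 r_descent r_ge0 r_small c0 t0 t1 rgt0 KLr dl th).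
exact: (rate_sublinear a0 C0 r_descent r_ge0 r_small c0 t0 t1 rgt0 KLr dl th).
Qed.

End KLConvergence.

(** * The proximal point iteration *)

Section Gppa.
Context {R : realType} {n : nat}.
Variables (f g1 : 'rV[R]_n -> \bar R) (g2 h : 'rV[R]_n -> R) (L t : R).
Variables (x y : nat -> 'rV[R]_n).
Let d k := enorm (x k.+1 - x k).
Hypotheses (fE : decomposition f g1 g2 h) (g1_gtNy : forall u, (-oo < g1 u)%E).
Hypotheses (lg2 : lipschitz_gradient L g2) (t0 : 0 < t).
Hypothesis x0_dom : edom g1 (x 0%N).
Hypothesis hy : forall k, subdiff h (x k) (y k).
Hypothesis x_prox : forall k,
  prox t g1 (x k - t^-1 *: (grad g2 (x k) - y k)) (x k.+1).

Lemma decomposition_fin u : (f u \is a fin_num) = (g1 u \is a fin_num).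
Proof. by rewrite fE; case: (g1 u) (g1_gtNy u). Qed.

Lemma decomposition_fine u : g1 u \is a fin_num ->
  fine (f u) = fine (g1 u) + g2 u - h u.
Proof. by rewrite fE => /fineK <-. Qed.

(** The minimizer is compared with [x k], where the proximal objective is finite by induction. *)
Lemma gppa_fin k : g1 (x k) \is a fin_num.
Proof.
elim: k => [|k]; rewrite !fin_numElt !g1_gtNy //= => IH.
have := x_prox k (x k); have := g1_gtNy (x k.+1).
move: IH; case: (g1 (x k)) => // r _; case: (g1 (x k.+1)) => // r' _.
Qed.

(** Expanding the proximal square around [x k] leaves a multiple of [dot c c] that cancels on both
    sides. *)
Lemma gppa_prox_le k u : g1 u \is a fin_num ->
  fine (g1 (x k.+1)) + dot (grad g2 (x k) - y k) (x k.+1 - x k) + t / 2 * d k ^+ 2 <=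
  fine (g1 u) + dot (grad g2 (x k) - y k) (u - x k) + t / 2 * enorm (u - x k) ^+ 2.
Proof.
move=> gu; have := x_prox k u; rewrite -(fineK gu) -(fineK (gppa_fin k.+1)).
rewrite -!EFinD lee_fin /=; set c := _ - y k; clearbody c.
have E v : t / 2 * enorm (v - (x k - t^-1 *: c)) ^+ 2 =
    t / 2 * enorm (v - x k) ^+ 2 + dot c (v - x k) + (2 * t)^-1 * dot c c.
  have -> : v - (x k - t^-1 *: c) = (v - x k) + t^-1 *: c by rewrite opprB addrCA addrC.
  move: (v - x k) => w.
  by rewrite !sqr_enorm !dotE (dotC w c); field; rewrite gt_eqF.
rewrite !E /d; lra.
Qed.

(** Adds to the proximal inequality the Taylor bounds for [g2] at [x k.+1] and [u] and the
    subgradient inequality for [h] at [x k.+1]. The choice [u = x k] gives descent, [u = xs] the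
    limit of the values. *)
Lemma gppa_master k u : g1 u \is a fin_num ->
  fine (f (x k.+1)) + (t - L) / 2 * d k ^+ 2 <=
  fine (f u) + (h u - h (x k) - dot (y k) (u - x k)) +
    (t + L) / 2 * enorm (u - x k) ^+ 2.
Proof.
move=> gu; have := gppa_prox_le k gu.
have := dist_taylor_le (x k) (x k.+1) lg2; have := dist_taylor_le (x k) u lg2.
rewrite !ler_norml => /andP[h1 _] /andP[_ h2].
have := hy k (x k.+1); rewrite -/(d k) in h2 *.
rewrite !decomposition_fine ?gppa_fin // ![dot (_ - y k) _]dotDl !dotNl.
lra.
Qed.

Lemma gppa_descent k :
  (t - L) / 2 * d k ^+ 2 <= fine (f (x k)) - fine (f (x k.+1)).
Proof.
have := gppa_master k (gppa_fin k).
by rewrite !subrr dotC dot0l enorm0 expr0n /= mulr0; lra.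
Qed.

Section ClusterPoint.
Variable xs : 'rV[R]_n.
Hypotheses (f_gtNy : forall u, (-oo < f u)%E) (flsc : lower_semicontinuous f) (Lt : L < t).
Hypothesis x_cluster :
  forall (e : R) N, 0 < e -> exists2 k, (N <= k)%N & enorm (x k - xs) < e.

(** If [f xs] exceeded [f (x k)], lower semicontinuity would make later iterates near [xs] exceed it
    too, against the monotonicity of the values. *)
Lemma gppa_cluster_le k : (f xs <= f (x k))%E.
Proof.
have fin j : f (x j) \is a fin_num by rewrite decomposition_fin gppa_fin.
rewrite leNgt; apply/negP; rewrite -(fineK (fin k)) => /flsc[V /nbhs_enormP[e e0 eV] VP].
have [j kj /eV/VP] := x_cluster k e0.
rewrite -(fineK (fin j)) lte_fin ltNge => /negP; apply.
apply: (@nonincreasing_seq_le _ (fun i => fine (f (x i)))) kj => i.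
rewrite -subr_ge0 (le_trans _ (gppa_descent i)) // mulr_ge0 ?sqr_ge0 //.
by rewrite divr_ge0 // subr_ge0 ltW.
Qed.

Lemma gppa_cluster_fin : f xs \is a fin_num.
Proof.
have := gppa_cluster_le 0; rewrite fin_numElt f_gtNy /= => /le_lt_trans; apply.
by rewrite ltey_eq decomposition_fin gppa_fin.
Qed.

(** Minimality of [x k.+1] is tested at [xs] for an [x k] near [xs], where the quadratic term and
    the linearization error of [h] are both small. *)
Lemma gppa_cluster_value :
  (forall e : R, 0 < e -> exists2 r : R, 0 < r & forall u v, enorm (xs - u) < r ->
     subdiff h u v -> h xs - h u - dot v (xs - u) < e) ->
  forall e : R, 0 < e -> exists k, fine (f (x k)) < fine (f xs) + e.
Proof.
move=> hlin e e0; have e2 : 0 < e / 2 by rewrite divr_gt0.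
have [r r0 rP] := hlin _ e2.
have L0 : 0 <= L by case: lg2.
have [|s [s0 _ sc]] := @small_scale R 0 ((t + L) / 2) (Num.min 1 (e / 2)).
  by rewrite lt_min ltr01.
pose q := Num.min r (Num.min 1 s).
have [|k _ kq] := x_cluster (e := q) 0; first by rewrite !lt_min r0 ltr01.
exists k.+1; move: kq; rewrite !lt_min => /and3P[kr k1 ks].
have := gppa_master k (u := xs); rewrite -decomposition_fin gppa_cluster_fin => /(_ isT).
rewrite enorm_distC in kr.
have := rP _ _ kr (hy k).
have tL : 0 <= (t + L) / 2 by rewrite divr_ge0 // addr_ge0 // ltW.
have : (t + L) / 2 * enorm (xs - x k) ^+ 2 <= (t + L) / 2 * s.
  rewrite ler_wpM2l // enorm_distC expr2 -[leRHS]mulr1.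
  by rewrite ler_pM ?enorm_ge0 // ltW.
have : 0 <= (t - L) / 2 * d k ^+ 2.
  by rewrite mulr_ge0 ?sqr_ge0 // divr_ge0 // subr_ge0 ltW.
move: sc; rewrite lt_min => /andP[_]; rewrite [s * _]mulrC.
move: ((t - L) / 2 * _) ((t + L) / 2 * s) ((t + L) / 2 * _) => A B D.
lra.
Qed.

End ClusterPoint.

(** [v] is the residual of the optimality condition of the proximal step. The proximal inequality
    and the Taylor bounds for [g2] and [h] add up to a quadratic lower bound for [f] at [u] with
    slope [v]. *)
Lemma gppa_dist0_limiting (Lh : R) k : lipschitz_gradient Lh h ->
  (dist0 (limiting_subdiff f (x k.+1)) <= ((L + Lh + t) * d k)%:E)%E.
Proof.
move=> lh; set u := x k.+1; set w := x k.
pose v := (grad g2 u - grad g2 w) - (grad h u - grad h w) - t *: (u - w).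
have yE : y k = grad h w := subdiff_grad lh (hy k).
have [L0 _ lip2] := lg2; have [Lh0 _ liph] := lh.
have vle : enorm v <= (L + Lh + t) * d k.
  rewrite (le_trans (ler_enormD _ _)) // enormN enormZ gtr0_norm //.
  by rewrite mulrDl lerD // (le_trans (ler_enormD _ _)) // enormN mulrDl lerD //.
apply: (@le_trans _ _ (enorm v)%:E); last by rewrite lee_fin.
apply: ereal_inf_lbound; exists v => //; apply: frechet_limiting.
have uf : g1 u \is a fin_num := gppa_fin k.+1.
apply: (@frechet_of_quadratic_lower _ _ _ _ _ ((L + Lh + t) / 2) 1) => //.
- by rewrite divr_ge0 // !addr_ge0 // ltW.
- by rewrite decomposition_fin.
move=> z _; have [zf|zf] := boolP (g1 z \is a fin_num); last first.
  have -> : f z = +oo%E by rewrite fE; move: zf (g1_gtNy z); case: (g1 z).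
  exact: leey.
have := gppa_prox_le k zf; have := dist_taylor_le u z lg2; have := dist_taylor_le u z lh.
rewrite !ler_norml => /andP[_ h1] /andP[h2 _].
rewrite -[f u]fineK ?decomposition_fin // -[f z]fineK ?decomposition_fin //.
rewrite !decomposition_fine // -EFinD lee_fin yE -/u -/w.
have E : z - w = (z - u) + (u - w) by rewrite addrA subrK.
rewrite /d -/u -/w E /v !sqr_enorm in h1 h2 *.
move: (z - u) (u - w) h1 h2 => p q h1 h2.
rewrite !dotE (dotC q p) /= in h1 h2 *.
lra.
Qed.

(** With [g1 = 0] the proximal step is a gradient step: comparing [x k.+1] with the explicit
    minimizer leaves a square that is at most 0. *)
Lemma gppa_gradient_step k : g1 = cst 0%E ->
  grad g2 (x k) - y k = - (t *: (x k.+1 - x k)).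
Proof.
move=> g10; apply/eqP; rewrite -addr_eq0; apply/eqP/enorm_eq0.
have := @gppa_prox_le k (x k - t^-1 *: (grad g2 (x k) - y k)).
rewrite g10 /= => /(_ isT); rewrite [x k - _ - x k]addrAC subrr !add0r /d !sqr_enorm.
move: (grad g2 (x k) - y k) (x k.+1 - x k) => c w H.
apply/eqP; rewrite -sqrf_eq0 eq_le sqr_ge0 andbT sqr_enorm.
have : 2 * t * (t / 2 * dot (- (t^-1 *: c)) (- (t^-1 *: c)) + dot c (- (t^-1 *: c))) = - dot c c.
  by rewrite !dotE; field; rewrite gt_eqF.
have t2 : 0 < 2 * t by rewrite mulr_gt0.
move: H; rewrite -(ler_pM2l t2) => H E.
rewrite !dotE (dotC w c); lra.
Qed.

End Gppa.


Theorem theorem3p11 (R : realType) (n : nat) (f g1 : 'rV[R]_n -> \bar R)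
    (g2 h : 'rV[R]_n -> R) (L t : R) (x : nat -> 'rV[R]_n)
    (sub : 'rV[R]_n -> set 'rV[R]_n) :
  proper_fun f -> lower_semicontinuous f -> semialgebraic f ->
  (-oo < ereal_inf (range f))%E ->
  L < t -> gppa g1 g2 h t x -> cluster (x @ \oo) !=set0 ->
  (setting_a f g1 g2 h L /\ sub = limiting_subdiff f) \/
  (setting_b f g1 g2 h L /\ sub = clarke_subdiff f) ->
  exists xstar : 'rV[R]_n, x @ \oo --> xstar /\
    forall c theta : R, 0 < c -> 0 <= theta < 1 ->
      KL_with sub f xstar (fun s => c * s `^ (1 - theta)) ->
      [/\ theta = 0 -> exists N, forall k, (N <= k)%N -> x k = xstar,
          0 < theta <= 2^-1 ->
            exists mu q : R, [/\ 0 < mu, 0 < q < 1 &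
              forall k, (1 <= k)%N -> enorm (x k - xstar) <= mu * q ^+ k] &
          2^-1 < theta < 1 ->
            exists2 mu : R, 0 < mu &
              forall k, (1 <= k)%N ->
                enorm (x k - xstar) <=
                mu * k%:R `^ ((1 - theta) / (1 - 2 * theta))].
Proof.
move=> [f_gtNy _] flsc _ _ Lt [x0 xP] [xs /cluster_enormP xcl] cases.
have /choice[y yP] k : exists y, subdiff h (x k) y /\
    prox t g1 (x k - t^-1 *: (grad g2 (x k) - y)) (x k.+1).
  by have [y] := xP k; exists y.
have hy k := (yP k).1; have hp k := (yP k).2; exists xs.
have [fE g1_gtNy lg] : [/\ decomposition f g1 g2 h, (forall u, (-oo < g1 u)%E) &
    lipschitz_gradient L g2].
  case: cases => [[[? [[? _] _] ? _ _] _]|[[? g10 ? _ _] _]]; first by [].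
  by split => // u; rewrite g10; exact: (ltNyr 0).
have L0 : 0 <= L by case: lg.
have t0 : 0 < t := le_lt_trans L0 Lt.
have ff k : f (x k) \is a fin_num.
  by rewrite (decomposition_fin fE g1_gtNy) (gppa_fin g1_gtNy x0 hp).
have a0 : 0 < (t - L) / 2 by rewrite divr_gt0 // subr_gt0.
have desc := gppa_descent fE g1_gtNy lg t0 x0 hy hp.
have fle := gppa_cluster_le fE g1_gtNy lg t0 x0 hy hp flsc Lt xcl.
have fin := gppa_cluster_fin fE g1_gtNy lg t0 x0 hy hp f_gtNy flsc Lt xcl.
have xs_dom : edom f xs by rewrite /edom /= ltey_eq fin.
pose d k := enorm (x k.+1 - x k).
(* The sum [d k + d k.+1] serves both settings: the proximal residual at [x k.+1] is controlled by
   [d k] in (a), the gradient step from [x k.+1] by [d k.+1] in (b). *)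
suff [small [C C0 sub_le] KLxs] : [/\
    (forall e : R, 0 < e -> exists k, fine (f (x k)) < fine (f xs) + e),
    (exists2 C, 0 < C & forall k,
      (dist0 (sub (x k.+1)) <= (C * (d k + d k.+1))%:E)%E) & KL sub f xs].
  split; first exact: (KL_descent_convergence a0 C0 ff fin desc fle small xcl sub_le KLxs).
  exact: (KL_descent_rates a0 C0 ff fin desc fle small xcl sub_le).
have small := gppa_cluster_value fE g1_gtNy lg t0 x0 hy hp f_gtNy flsc Lt xcl.
case: cases => [[[_ _ _ [hc [Lh lh]] KLf] ->]|[[_ g10 _ hc KLf] ->]].
  have Lh0 : 0 <= Lh by case: lh.
  split; last exact: KLf.
    (* The linearization error of [h] is at most [Lh / 2] times the squared distance, hence below
       [e] at distances under 1 and [r]. *)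
    apply: small => e e0; have [r [r0 _ rL]] := small_scale 0 (Lh / 2) e0.
    exists (Num.min 1 r) => [|u v]; first by rewrite lt_min ltr01.
    rewrite lt_min => /andP[u1 ur] /(subdiff_grad lh) ->.
    have := dist_taylor_le u xs lh; rewrite ler_norml => /andP[_ H].
    have : Lh / 2 * enorm (xs - u) ^+ 2 <= Lh / 2 * r.
      rewrite ler_wpM2l ?divr_ge0 // expr2 -[leRHS]mul1r.
      by rewrite ler_pM ?enorm_ge0 // ltW.
    move: H rL; rewrite [r * _]mulrC; lra.
  exists (L + Lh + t); first by rewrite ltr_wpDl // addr_ge0.
  move=> k; apply: le_trans (gppa_dist0_limiting fE g1_gtNy lg t0 x0 hy hp k lh) _.
  by rewrite lee_fin ler_pM2l ?ltr_wpDl ?addr_ge0 // lerDl enorm_ge0.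
pose F u := fine (f u).
have FE u : F u = g2 u - h u.
  by rewrite /F (decomposition_fine fE) g10 //= add0r.
have fF : f = EFin \o F.
  by apply/funext => u; rewrite /F /= fineK // (decomposition_fin fE g1_gtNy) g10.
have Flsc : lower_semicontinuous (EFin \o F) by rewrite -fF.
have Fc := dc_continuous FE lg hc Flsc.
split; last exact: KLf.
  (* In setting (b) [F] is continuous, so an iterate close to the cluster point already has a close
     value. *)
  move=> e e0; have [r r0 rP] := (continuous_enormP F xs).1 (Fc xs) e e0.
  have [k _ /rP] := xcl r 0%N r0; rewrite ltr_norml => /andP[_ H].
  by exists k; rewrite -ltrBlDl.
exists t => // k; rewrite fF.
apply: le_trans (dist0_clarke_le FE lg hc Flsc (hy k.+1)) _.
rewrite lee_fin.
rewrite (gppa_gradient_step g1_gtNy t0 x0 hp) // enormN enormZ gtr0_norm // ler_pM2l // lerDr.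
exact: enorm_ge0.
Qed.
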